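(* Assume that $Y_V$ satisfies the spectral density condition and is purely non-deterministic. (a) Let $G_{OG}=(V,E_{OG})$ be the orthogonality graph for $Y_V$, with $\mathrm{pa}(A)$ and $\mathrm{ne}(A)$ formed in $G_{OG}$. Then $Y_V$ satisfies the block-recursive Markov property with respect to $G_{OG}$, i.e., for all $A\subseteq V$: (i) $Y_{V\setminus(\mathrm{pa}(A)\cup A)}\not\to Y_A\mid Y_V$, (ii) $Y_{V\setminus(\mathrm{ne}(A)\cup A)}\not\sim Y_A\mid Y_V$. (b) Suppose moreover that every component $Y_v$, $v\in V$, is $j_v$-times mean-square differentiable but not $(j_v+1)$-times, and let $G^0_{OG}=(V,E^0_{OG})$ be the local orthogonality graph for $Y_V$, with $\mathrm{pa}(A)$ and $\mathrm{ne}(A)$ formed in $G^0_{OG}$. Then $Y_V$ satisfies the block-recursive Markov property with respect to $G^0_{OG}$, i.e., for all $A\subseteq V$: (i) $Y_{V\setminus(\mathrm{pa}(A)\cup A)}\not\to_0 Y_A\mid Y_V$, (ii) $Y_{V\setminus(\mathrm{ne}(A)\cup A)}\not\sim_0 Y_A\mid Y_V$.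
   Context: $V=\{1,\ldots,k\}$ and $Y_V=(Y_V(t))_{t\in\mathbb{R}}$ is a $k$-dimensional weakly stationary process with expectation zero, continuous in mean square, with components $Y_v$ and subprocesses $Y_A=(Y_a)_{a\in A}$. $L^2$ is the Hilbert space of square-integrable complex random variables with $\langle X,Y\rangle=\mathbb{E}[X\overline{Y}]$; $P_{\mathcal L}$ is orthogonal projection onto a closed subspace. $\mathcal{L}_{Y_A}(s,t)$ is the closed linear span of $\{Y_a(u):a\in A,u\in[s,t]\cap\mathbb{R}\}$ and $\mathcal{L}_{Y_A}(t)=\mathcal{L}_{Y_A}(-\infty,t)$ ($=\{0\}$ if $A=\emptyset$). $\mathcal{L}_1\perp\mathcal{L}_2\mid\mathcal{L}_3$ means $\mathbb{E}[(X-P_{\mathcal{L}_3}X)\overline{(Y-P_{\mathcal{L}_3}Y)}]=0$ for all $X\in\mathcal{L}_1,Y\in\mathcal{L}_2$. $D^{(j)}$ denotes the $j$-th mean-square derivative, $D^{(0)}Y_v=Y_v$; l.i.m. is the $L^2$-limit. Relations, for $A,B\subseteq S\subseteq V$, $A\cap B=\emptyset$ (all relations are understood to hold trivially if $A$ or $B$ is empty): - $Y_A\not\to Y_B\mid Y_S$: $\mathcal{L}_{Y_B}(t,t+1)\perp\mathcal{L}_{Y_A}(t)\mid\mathcal{L}_{Y_{S\setminus A}}(t)$ for all $t\in\mathbb{R}$. - $Y_A\not\sim Y_B\mid Y_S$: $\mathcal{L}_{Y_A}(t,t+1)\perp\mathcal{L}_{Y_B}(t,t+1)\mid\mathcal{L}_{Y_S}(t)$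 for all $t\in\mathbb{R}$. - $Y_A\not\to_0 Y_B\mid Y_S$: for all $t\in\mathbb{R}$, $b\in B$, with $Q_{b,h}=h^{-1}(D^{(j_b)}Y_b(t+h)-D^{(j_b)}Y_b(t))$, the limits $\mathrm{l.i.m.}_{h\downarrow0}P_{\mathcal{L}_{Y_S}(t)}Q_{b,h}$ and $\mathrm{l.i.m.}_{h\downarrow0}P_{\mathcal{L}_{Y_{S\setminus A}}(t)}Q_{b,h}$ exist and are a.s. equal. - $Y_A\not\sim_0 Y_B\mid Y_S$: for all $t\in\mathbb{R}$, $a\in A$, $b\in B$, $\lim_{h\downarrow0}\frac1h\mathbb{E}[(D^{(j_a)}Y_a(t+h)-P_{\mathcal{L}_{Y_S}(t)}D^{(j_a)}Y_a(t+h))\overline{(D^{(j_b)}Y_b(t+h)-P_{\mathcal{L}_{Y_S}(t)}D^{(j_b)}Y_b(t+h))}]=0$. Spectral density condition: $Y_V$ has a spectral density matrix $f_{Y_VY_V}(\cdot)>0$ (positive definite) and there is $0<\varepsilon<1$ such that $(1-\varepsilon)I_\alpha-f_{Y_AY_A}(\lambda)^{-1/2}f_{Y_AY_B}(\lambda)f_{Y_BY_B}(\lambda)^{-1}f_{Y_BY_A}(\lambda)f_{Y_AY_A}(\lambda)^{-1/2}$ is positive semi-definite for almost all $\lambda\in\mathbb{R}$ and all disjoint $A,B\subseteq V$, $\#A=\alpha$ (here $f_{Y_AY_B}$ is the $A\times B$ block of $f_{Y_VY_V}$). Purely non-deterministic: $\bigcap_{t\in\mathbb{R}}\mathcal{L}_{Y_V}(t)=\{0\}$.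 Graphs: both have vertex set $V$, directed edges $a\to b$ and undirected edges $a\,\text{-}\,\text{-}\,b$ for $a\ne b$. In the orthogonality graph $G_{OG}$: $a\to b\notin E_{OG}$ iff $Y_a\not\to Y_b\mid Y_V$, and $a\,\text{-}\,\text{-}\,b\notin E_{OG}$ iff $Y_a\not\sim Y_b\mid Y_V$. In the local orthogonality graph $G_{OG}^0$: $a\to b\notin E^0_{OG}$ iff $Y_a\not\to_0Y_b\mid Y_V$, and $a\,\text{-}\,\text{-}\,b\notin E^0_{OG}$ iff $Y_a\not\sim_0Y_b\mid Y_V$. $\mathrm{pa}(a)=\{v:v\to a\in E\}$, $\mathrm{ne}(a)=\{v:v\,\text{-}\,\text{-}\,a\in E\}$, $\mathrm{pa}(A)=\bigcup_{a\in A}\mathrm{pa}(a)$, $\mathrm{ne}(A)=\bigcup_{a\in A}\mathrm{ne}(a)$. *)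

(* Defs.v *)
From HB Require Import structures.
From mathcomp Require Import all_boot all_order all_algebra.
From mathcomp Require Import complex.
From mathcomp Require Import all_classical all_reals all_analysis.

Set Implicit Arguments.
Unset Strict Implicit.
Unset Printing Implicit Defensive.

Import Order.TTheory GRing.Theory Num.Theory.
Import numFieldNormedType.Exports.

Local Open Scope classical_set_scope.
Local Open Scope ring_scope.
Local Open Scope complex_scope.

Notation normc := ComplexField.Normc.normc.

Section Integration.
Context (d : measure_display) (T : measurableType d) (R : realType).
Variable mu : {measure set T -> \bar R}.

Definition cmeasurable (f : T -> R[i]) : Prop :=
  measurable_fun setT (fun x => complex.Re (f x)) /\
  measurable_fun setT (fun x => complex.Im (f x)).

Definition cintegrable (f : T -> R[i]) : Prop :=
  mu.-integrable setT (fun x => (complex.Re (f x))%:E) /\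
  mu.-integrable setT (fun x => (complex.Im (f x))%:E).

Definition cintegral (f : T -> R[i]) : R[i] :=
  (\int[mu]_x complex.Re (f x)) +i* (\int[mu]_x complex.Im (f x)).

End Integration.

Section Matrices.
Context (C : numClosedFieldType).
Local Open Scope sesquilinear_scope.

(* Over C, "0 <= z" entails that z is real, so that these conditions force M
   to be Hermitian. *)
Definition posdefmx n (M : 'M[C]_n) : Prop :=
  forall x : 'rV[C]_n, x != 0 -> 0 < (x *m M *m x^t*) 0 0.

Definition possemidefmx n (M : 'M[C]_n) : Prop :=
  forall x : 'rV[C]_n, 0 <= (x *m M *m x^t*) 0 0.

Definition sqrtmx n (M : 'M[C]_n) : 'M[C]_n :=
  xget 0 [set S | possemidefmx S /\ S *m S = M].

Definition invsqrtmx n (M : 'M[C]_n) : 'M[C]_n := invmx (sqrtmx M).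

Definition blockmx k (M : 'M[C]_k) (A B : {set 'I_k}) : 'M[C]_(#|A|, #|B|) :=
  mxsub (fun i : 'I_#|A| => enum_val i) (fun j : 'I_#|B| => enum_val j) M.

End Matrices.

(* Square-integrable complex random variables are represented by functions
   T -> R[i]; the elements of the Hilbert space L^2 are their classes modulo
   almost sure equality, so every "closed subspace" below is a set of
   functions that is saturated, among the measurable ones, for almost sure
   equality. *)
Section L2.
Context (R : realType) (d : measure_display) (T : measurableType d).
Variable P : probability T R.
Implicit Types X Y Z W : T -> R[i].

Definition as_eq X Y : Prop := {ae P, forall w, X w = Y w}.

Definition second_moment X : \bar R := (\int[P]_w (normc (X w) ^+ 2)%:E)%E.

Definition L2 : set (T -> R[i]) :=
  [set X | cmeasurable X /\ (second_moment X < +oo)%E].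

Definition inner X Y : R[i] := cintegral P (fun w => X w * (Y w)^*).

Definition ms_lim (I : Type) (F : set_system I) (X : I -> T -> R[i]) W : Prop :=
  L2 W /\ second_moment (X i \- W) @[i --> F] --> 0%E.

Definition lin_span (G : set (T -> R[i])) : set (T -> R[i]) :=
  [set X | exists (n : nat) (c : 'I_n -> R[i]) (g : 'I_n -> T -> R[i]),
     (forall i, G (g i)) /\ X = (fun w => \sum_(i < n) c i * g i w)].

Definition closed_span (G : set (T -> R[i])) : set (T -> R[i]) :=
  [set X | L2 X /\ forall e : R, 0 < e ->
     exists Z, lin_span G Z /\ (second_moment (X \- Z)%R < e%:E)%E].

(* A representative of the orthogonal projection of X on the closed subspace
   L, which is determined up to almost sure equality. *)
Definition ortho_proj (L : set (T -> R[i])) X : T -> R[i] :=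
  xget (fun=> 0) [set Z | L Z /\ forall W, L W -> inner (X \- Z) W = 0].

Definition cond_orth (M1 M2 M3 : set (T -> R[i])) : Prop :=
  forall X Y, M1 X -> M2 Y -> inner (X \- ortho_proj M3 X) (Y \- ortho_proj M3 Y) = 0.

Definition ms_quotient (X : R -> T -> R[i]) (t h : R) : T -> R[i] :=
  fun w => (h^-1)%:C * (X (t + h) w - X t w).

Definition ms_derivable (X : R -> T -> R[i]) : Prop :=
  forall t, exists W, ms_lim (0 : R)^' (ms_quotient X t) W.

Definition ms_deriv (X : R -> T -> R[i]) : R -> T -> R[i] :=
  fun t => xget (fun=> 0) [set W | ms_lim (0 : R)^' (ms_quotient X t) W].

Definition ms_derivn (j : nat) (X : R -> T -> R[i]) : R -> T -> R[i] :=
  iter j ms_deriv X.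

Definition ms_derivablen (j : nat) (X : R -> T -> R[i]) : Prop :=
  forall i, (i < j)%N -> ms_derivable (ms_derivn i X).

End L2.

Section Processes.
Context (R : realType) (d : measure_display) (T : measurableType d).
Variables (P : probability T R) (k : nat) (Y : 'I_k -> R -> T -> R[i]).
Implicit Types (A B S : {set 'I_k}) (a b v : 'I_k) (t : R).

Definition weakly_stationary : Prop :=
  (forall v t, L2 P (Y v t)) /\
  (forall v s t, cintegral P (Y v s) = cintegral P (Y v t)) /\
  (forall a b s t h,
     inner P (Y a (s + h)) (Y b (t + h)) = inner P (Y a s) (Y b t)).

Definition centered : Prop := forall v t, cintegral P (Y v t) = 0.

Definition ms_continuous : Prop :=
  forall v t, ms_lim P (nbhs t) (Y v) (Y v t).

Definition Lspan A (I : interval R) : set (T -> R[i]) :=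
  closed_span P [set X | exists a u, [/\ a \in A, u \in I & X = Y a u]].

Definition Lpast A t := Lspan A `]-oo, t].

Definition purely_nondeterministic : Prop :=
  forall X, (forall t, Lpast [set: 'I_k]%SET t X) -> as_eq P X (fun=> 0).

(* Convention: the autocovariance function is h |-> \int e^{i l h} f(l) dl; a
   normalizing factor such as 1/(2 pi) would not affect the condition below,
   which is invariant under multiplication of f by a positive constant. *)
Definition spectral_density (f : R -> 'M[R[i]]_k) : Prop :=
  (forall a b, cintegrable (@lebesgue_measure R) (fun l => f l a b)) /\
  (forall a b t h,
     inner P (Y a (t + h)) (Y b t) =
     cintegral (@lebesgue_measure R)
       (fun l => (cos (l * h) +i* sin (l * h)) * f l a b)).

Definition spectral_density_condition : Prop :=
  exists f : R -> 'M[R[i]]_k,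
    [/\ spectral_density f,
        forall l, posdefmx (f l)
      & exists e : R, [/\ 0 < e, e < 1 &
          {ae @lebesgue_measure R, forall l, forall A B, [disjoint A & B]%B ->
             possemidefmx
               ((1 - e)%:C%:M -
                invsqrtmx (blockmx (f l) A A) *m blockmx (f l) A B *m
                invmx (blockmx (f l) B B) *m blockmx (f l) B A *m
                invsqrtmx (blockmx (f l) A A))}]].

(* In the four relations below A and B are meant to be disjoint subsets of
   S. *)
Definition not_causes A B S : Prop :=
  A = finset.set0 \/ B = finset.set0 \/ forall t,
  cond_orth P (Lspan B `[t, t + 1]) (Lpast A t) (Lpast (S :\: A) t).

Definition not_contemp A B S : Prop :=
  A = finset.set0 \/ B = finset.set0 \/ forall t,
  cond_orth P (Lspan A `[t, t + 1]) (Lspan B `[t, t + 1]) (Lpast S t).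

Variable j : 'I_k -> nat.

Definition DY v : R -> T -> R[i] := ms_derivn P (j v) (Y v).

Definition not_causes0 A B S : Prop :=
  A = finset.set0 \/ B = finset.set0 \/ forall t b, b \in B ->
  exists W W',
    [/\ ms_lim P (0 : R)^'+
          (fun h => ortho_proj P (Lpast S t) (ms_quotient (DY b) t h)) W,
        ms_lim P (0 : R)^'+
          (fun h => ortho_proj P (Lpast (S :\: A) t) (ms_quotient (DY b) t h)) W'
      & as_eq P W W'].

Definition not_contemp0 A B S : Prop :=
  A = finset.set0 \/ B = finset.set0 \/
  forall t a b, a \in A -> b \in B ->
  normc ((h^-1)%:C *
         inner P (DY a (t + h) \- ortho_proj P (Lpast S t) (DY a (t + h)))
                 (DY b (t + h) \- ortho_proj P (Lpast S t) (DY b (t + h))))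
    @[h --> (0 : R)^'+] --> (0 : R).

End Processes.

Record mixed_graph (V : finType) := MixedGraph {
  dedge : rel V;  (* dedge a b: there is a directed edge from a to b *)
  uedge : rel V
}.

Section Graphs.
Context (V : finType).
Implicit Types (G : mixed_graph V) (A : {set V}).

Definition pa G A : {set V} :=
  (\bigcup_(a in A) [set v | dedge G v a])%SET.

Definition ne G A : {set V} :=
  (\bigcup_(a in A) [set v | uedge G v a])%SET.

End Graphs.

Section OrthogonalityGraphs.
Context (R : realType) (d : measure_display) (T : measurableType d).
Variables (P : probability T R) (k : nat) (Y : 'I_k -> R -> T -> R[i]).

Definition orthogonality_graph : mixed_graph 'I_k :=
  MixedGraph
    (fun a b => (a != b) && ~~ `[< not_causes P Y [set a]%SET [set b]%SET [set: 'I_k]%SET >])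
    (fun a b => (a != b) && ~~ `[< not_contemp P Y [set a]%SET [set b]%SET [set: 'I_k]%SET >]).

Definition local_orthogonality_graph (j : 'I_k -> nat) : mixed_graph 'I_k :=
  MixedGraph
    (fun a b => (a != b) && ~~ `[< not_causes0 P Y j [set a]%SET [set b]%SET [set: 'I_k]%SET >])
    (fun a b => (a != b) && ~~ `[< not_contemp0 P Y j [set a]%SET [set b]%SET [set: 'I_k]%SET >]).

End OrthogonalityGraphs.

(* Main.v *)
Require Import Defs.
From HB Require Import structures.
From mathcomp Require Import all_boot all_order all_algebra.
From mathcomp Require Import complex ring lra.
From mathcomp Require Import all_classical all_reals all_analysis.
From mathcomp Require Import measurable_realfun.

(** Both parts reduce from blocks to pairs of vertices.

    The undirected statements are bilinear. Conditional orthogonality of two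
    closed spans can be tested on generators [cond_orth_closed_span], and a
    generator of the span of a block belongs to the span of a single component;
    the local relation quantifies over pairs of components from the start.

    The directed statements rest on the intersection property
    [L_S1(t) /\ L_S2(t) = L_(S1 /\ S2)(t)] of the pasts [Lspan_setI]. If [X] is
    orthogonal to the past of [b] given the past of all other components, then
    the projection of [X] on the full past does not involve [b]
    [proj_past_avoids]. When this holds for every [b] of a block [B], the
    projection lies in the past of the complement of [B] [Lspan_setD], so it is
    also the projection of [X] on that smaller past, and the residual of [X] is
    orthogonal to the full past, in particular to the past of [B]. In the local
    version the same argument applies to the mean-square limit of the projected
    difference quotients, and projecting on the smaller past only brings the
    quotients closer to this limit.

    The intersection property is where the spectral density condition enters.
    The condition says that the Schur complement of the spectral density with
    respect to a block [A] dominates a fixed multiple of the diagonal block of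
    [A]. Completing the square [schur_form_ge] and integrating over the
    frequencies through the spectral isometry [spectral_isometry], one gets
    [e * |X|^2 <= |X + Z|^2] for [X] and [Z] in the spans of disjoint
    subprocesses [disjoint_span_angle]: such spans form a positive angle. If
    now [W] is close both to [U + V], with [U] over [S1 /\ S2] and [V] over
    [S1 \ S2], and to some [X'] over [S2], then [V + (U - X')] is small, hence
    [V] is small, and [W] is close to [U].

    The projections exist because square-integrable variables form a complete
    space [L2_fast_cauchy_cvg]; the projection is the limit of a minimizing
    sequence [ortho_proj_ex]. Random variables are not identified when they are
    almost surely equal, so equalities between projections take the form
    [nrm2 P (X \- Y) = 0]. *)

Set Implicit Arguments.
Unset Strict Implicit.
Unset Printing Implicit Defensive.

Import Order.TTheory GRing.Theory Num.Theory.
Import numFieldNormedType.Exports.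

Local Open Scope classical_set_scope.
Local Open Scope ring_scope.
Local Open Scope complex_scope.

(** * Integrals of complex functions *)

Section ComplexParts.
Context (R : realType).
Implicit Types x y : R[i].

Lemma cReD x y : complex.Re (x + y) = complex.Re x + complex.Re y.
Proof. by case: x y => [a b] [c e]. Qed.

Lemma cImD x y : complex.Im (x + y) = complex.Im x + complex.Im y.
Proof. by case: x y => [a b] [c e]. Qed.

Lemma cReB x y : complex.Re (x - y) = complex.Re x - complex.Re y.
Proof. by case: x y => [a b] [c e]. Qed.

Lemma cImB x y : complex.Im (x - y) = complex.Im x - complex.Im y.
Proof. by case: x y => [a b] [c e]. Qed.

Lemma cReM x y : complex.Re (x * y) =
  complex.Re x * complex.Re y - complex.Im x * complex.Im y.
Proof. by case: x y => [a b] [c e]. Qed.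

Lemma cImM x y : complex.Im (x * y) =
  complex.Re x * complex.Im y + complex.Im x * complex.Re y.
Proof. by case: x y => [a b] [c e]. Qed.

Lemma cReJ x : complex.Re x^* = complex.Re x. Proof. by case: x. Qed.

Lemma cImJ x : complex.Im x^* = - complex.Im x. Proof. by case: x. Qed.

Lemma normc2E x : normc x ^+ 2 = complex.Re x ^+ 2 + complex.Im x ^+ 2.
Proof. by case: x => a b; rewrite sqr_sqrtr// addr_ge0// sqr_ge0. Qed.

Lemma mulJE x : x * x^*%C = (normc x ^+ 2)%:C.
Proof. by rewrite normc2E; case: x => a b; simpc; congr (_ +i* _); ring. Qed.

Lemma normc2_real (a : R) : normc a%:C ^+ 2 = a ^+ 2.
Proof. by rewrite normc2E /= expr0n addr0. Qed.

Lemma conjc_realM (a : R) x : (a%:C * x)^*%C = a%:C * x^*%C.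
Proof. by case: x => b e; simpc. Qed.

Lemma normcM2 x y : normc (x * y) ^+ 2 = normc x ^+ 2 * normc y ^+ 2.
Proof. by rewrite ComplexField.Normc.normcM exprMn. Qed.

Lemma normcD2_le x y :
  normc (x + y) ^+ 2 <= 2 * normc x ^+ 2 + 2 * normc y ^+ 2.
Proof.
rewrite !normc2E cReD cImD; case: x y => [a b] [e f] /=.
by have := (sqr_ge0 (a - e), sqr_ge0 (b - f)); rewrite !sqrrB !sqrrD => -[];
  lra.
Qed.

Lemma normcJ2 x : normc x^* ^+ 2 = normc x ^+ 2.
Proof. by rewrite !normc2E cReJ cImJ sqrrN. Qed.

Lemma normcM_bound x y (s := normc x ^+ 2 + normc y ^+ 2) :
  (`|complex.Re (x * y)| <= `|s|) && (`|complex.Im (x * y)| <= `|s|).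
Proof.
rewrite (ger0_norm (addr_ge0 (sqr_ge0 _) (sqr_ge0 _))) /s !normc2E cReM cImM.
case: x y @s => [a b] [e f] _ /=.
have := (sqr_ge0 (a - e), sqr_ge0 (a + e), sqr_ge0 (b - f), sqr_ge0 (b + f),
  sqr_ge0 (a - f), sqr_ge0 (a + f), sqr_ge0 (b - e), sqr_ge0 (b + e)).
rewrite !ler_norml => -[[[[[[[]]]]]]].
do 4 (rewrite sqrrB sqrrD => ? ?).
by apply/andP; split; apply/andP; split; lra.
Qed.

End ComplexParts.

Section ComplexIntegral.
Context (d : measure_display) (T : measurableType d) (R : realType).
Variable mu : {measure set T -> \bar R}.
Implicit Types f g : T -> R[i].

Lemma cintegrableD f g : cintegrable mu f -> cintegrable mu g ->
  cintegrable mu (f \+ g).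
Proof.
move=> [fr fi] [gr gi]; split.
  by under eq_fun do rewrite cReD EFinD; exact: integrableD.
by under eq_fun do rewrite cImD EFinD; exact: integrableD.
Qed.

Lemma cintegralD f g : cintegrable mu f -> cintegrable mu g ->
  cintegral mu (f \+ g) = cintegral mu f + cintegral mu g.
Proof.
move=> [fr fi] [gr gi]; rewrite /cintegral; simpc; congr (_ +i* _).
  by under eq_Rintegral do rewrite cReD; rewrite RintegralD.
by under eq_Rintegral do rewrite cImD; rewrite RintegralD.
Qed.

Let integrable_lin (a b : R) (f g : T -> R) :
  mu.-integrable setT (EFin \o f) -> mu.-integrable setT (EFin \o g) ->
  mu.-integrable setT (EFin \o (fun x => a * f x + b * g x)).
Proof.
move=> fi gi; have := integrableD measurableT (integrableZl measurableT a fi)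
  (integrableZl measurableT b gi).
by apply: eq_integrable => // x _; rewrite /= EFinD !EFinM.
Qed.

Let Rintegral_lin (a b : R) (f g : T -> R) :
  mu.-integrable setT (EFin \o f) -> mu.-integrable setT (EFin \o g) ->
  \int[mu]_x (a * f x + b * g x) = a * \int[mu]_x f x + b * \int[mu]_x g x.
Proof.
move=> fi gi; rewrite RintegralD// ?RintegralZl//.
  by have := integrableZl measurableT a fi; apply: eq_integrable.
by have := integrableZl measurableT b gi; apply: eq_integrable.
Qed.

Lemma cintegrableZ c f : cintegrable mu f -> cintegrable mu (c \*o f).
Proof.
move=> [fr fi]; split.
  by under eq_fun do rewrite cReM -mulNr; exact: integrable_lin.
by under eq_fun do rewrite cImM; exact: integrable_lin.
Qed.

Lemma cintegralZ c f : cintegrable mu f ->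
  cintegral mu (c \*o f) = c * cintegral mu f.
Proof.
move=> [fr fi]; rewrite /cintegral; case: c => a b; simpc; congr (_ +i* _).
  by under eq_Rintegral do rewrite cReM -mulNr; rewrite Rintegral_lin// mulNr.
by under eq_Rintegral do rewrite cImM; rewrite Rintegral_lin.
Qed.

Lemma cintegral_conj f : cintegrable mu f ->
  cintegral mu (fun x => (f x)^*) = (cintegral mu f)^*.
Proof.
move=> [fr fi]; rewrite /cintegral; simpc; congr (_ +i* _).
  by under eq_Rintegral do rewrite cReJ.
under eq_Rintegral do rewrite cImJ -mulN1r.
by rewrite RintegralZl// mulN1r.
Qed.

Lemma cintegral0 : cintegral mu (fun=> 0) = 0.
Proof. by rewrite /cintegral !Rintegral_cst// mul0r. Qed.

(** The intended bounded factors are the characters [l |-> exp (i l h)]. *)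
Lemma cintegrableM_bounded f g : cmeasurable f ->
  (forall x, `|complex.Re (f x)| <= 1) -> (forall x, `|complex.Im (f x)| <= 1)
    ->
  cintegrable mu g -> cintegrable mu (fun x => f x * g x).
Proof.
move=> [mr mi] fr1 fi1 [gr gi].
have H (h k : T -> R) : measurable_fun setT h -> (forall x, `|h x| <= 1) ->
    mu.-integrable setT (EFin \o k) ->
    mu.-integrable setT (EFin \o (fun x => h x * k x)).
  move=> mh h1 ki; apply: (@le_integrable _ _ _ mu setT measurableT _ (EFin \o
    k)) => //.
    apply/measurable_EFinP/measurable_funM => //.
    by have /measurable_int/measurable_EFinP := ki.
  by move=> x _ /=; rewrite lee_fin normrM ler_piMl.
split.
  under eq_fun do rewrite cReM EFinB.
  by apply: integrableB => //; exact: H.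
under eq_fun do rewrite cImM EFinD.
by apply: integrableD => //; exact: H.
Qed.

Lemma ae_imply (A B : T -> Prop) : (forall x, A x -> B x) ->
  {ae mu, forall x, A x} -> {ae mu, forall x, B x}.
Proof. by move=> AB; apply: filterS. Qed.

Lemma ae_cintegral_ge0 f : cintegrable mu f ->
  {ae mu, forall x, 0 <= complex.Re (f x)} -> 0 <= complex.Re (cintegral mu f).
Proof.
move=> [fr _] f0 /=.
have mf : measurable_fun setT (fun x => complex.Re (f x)).
  by have /measurable_int/measurable_EFinP := fr.
rewrite [leRHS](_ : _ = \int[mu]_x `|complex.Re (f x)|); last first.
  congr fine; apply: ae_eq_integral => //.
  - exact/measurable_EFinP.
  - by apply/measurable_EFinP; exact: measurableT_comp.
  - by apply: filterS f0 => x f0x _; rewrite ger0_norm.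
by apply: Rintegral_ge0.
Qed.

End ComplexIntegral.

(** * The pre-Hilbert space of square-integrable random variables *)

Section PreHilbert.
Context (R : realType) (d : measure_display) (T : measurableType d).
Variable P : probability T R.
Implicit Types (X Y Z W : T -> R[i]) (c : R[i]).

(** The square of the norm, as a real number; on [L2] it is the value of
    [second_moment] by [second_momentE]. *)
Definition nrm2 X : R := complex.Re (inner P X X).

Lemma measurable_normc2 X : cmeasurable X ->
  measurable_fun setT (fun w => normc (X w) ^+ 2).
Proof.
move=> [mr mi]; under eq_fun do rewrite normc2E.
by apply: measurable_funD; exact: measurable_funX.
Qed.

Lemma cmeasurableD X Y : cmeasurable X -> cmeasurable Y -> cmeasurable (X \+ Y).
Proof.
move=> [Xr Xi] [Yr Yi]; split.
  by under eq_fun do rewrite cReD; exact: measurable_funD.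
by under eq_fun do rewrite cImD; exact: measurable_funD.
Qed.

Lemma cmeasurableZ c X : cmeasurable X -> cmeasurable (c \*o X).
Proof.
move=> [Xr Xi]; split.
  under eq_fun do rewrite cReM.
  by apply: measurable_funB; apply: measurable_funM.
under eq_fun do rewrite cImM.
by apply: measurable_funD; apply: measurable_funM.
Qed.

Lemma L2P X : L2 P X <-> cmeasurable X /\
  P.-integrable setT (EFin \o (fun w => normc (X w) ^+ 2)).
Proof.
split=> -[mX X2]; split => //.
  apply/integrableP; split.
    exact/measurable_EFinP/measurable_normc2.
  by under eq_integral do rewrite /= ger0_norm ?sqr_ge0//.
move/integrableP : X2 => [_].
by under eq_integral do rewrite /= ger0_norm ?sqr_ge0//.
Qed.

Lemma second_moment_ge0 X : (0 <= second_moment P X)%E.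
Proof. by apply: integral_ge0 => w _; rewrite lee_fin sqr_ge0. Qed.

Lemma cintegrable_inner X Y : L2 P X -> L2 P Y ->
  cintegrable P (fun w => X w * (Y w)^*).
Proof.
move=> /L2P[[Xr Xi] X2] /L2P[[Yr Yi] Y2].
have dom := integrableD measurableT X2 Y2.
split; apply: (le_integrable measurableT _ _ dom).
- apply/measurable_EFinP; under eq_fun do rewrite cReM cReJ cImJ mulrN opprK.
  by apply: measurable_funD; apply: measurable_funM.
- move=> w _ /=; rewrite lee_fin -(normcJ2 (Y w)).
  by have /andP[] := normcM_bound (X w) (Y w)^*.
- apply/measurable_EFinP; under eq_fun do rewrite cImM cReJ cImJ mulrN addrC.
  by apply: measurable_funB; apply: measurable_funM.
- move=> w _ /=; rewrite lee_fin -(normcJ2 (Y w)).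
  by have /andP[] := normcM_bound (X w) (Y w)^*.
Qed.

Lemma L2D X Y : L2 P X -> L2 P Y -> L2 P (X \+ Y).
Proof.
move=> /L2P[mX X2] /L2P[mY Y2]; apply/L2P; split; first exact: cmeasurableD.
have dom := integrableZl measurableT 2 (integrableD measurableT X2 Y2).
apply: (le_integrable measurableT _ _ dom).
  by apply/measurable_EFinP/measurable_normc2; exact: cmeasurableD.
move=> w _ /=; rewrite lee_fin ger0_norm ?sqr_ge0// (le_trans _ (ler_norm _))//.
rewrite !normc2E cReD cImD.
move: (complex.Re _) (complex.Im _) (complex.Re _) (complex.Im _) => a b e f.
rewrite -subr_ge0 (_ : _ - _ = (a - e) ^+ 2 + (b - f) ^+ 2); last by ring.
by rewrite addr_ge0 ?sqr_ge0.
Qed.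

Lemma L2Z c X : L2 P X -> L2 P (c \*o X).
Proof.
move=> /L2P[mX X2]; apply/L2P; split; first exact: cmeasurableZ.
have := integrableZl measurableT (normc c ^+ 2) X2.
by apply: eq_integrable => // w _; rewrite /= normcM2 EFinM.
Qed.

Lemma L2_0 : L2 P (fun=> 0).
Proof.
split; first by split => /=.
rewrite (_ : second_moment _ _ = 0%E)//.
apply: integral0_eq => w _.
by rewrite normc2E/= expr0n/= addr0.
Qed.

Lemma subfunE X Y : X \- Y = X \+ ((-1) \*o Y).
Proof. by apply/funext => w /=; rewrite mulN1r. Qed.

Lemma L2B X Y : L2 P X -> L2 P Y -> L2 P (X \- Y).
Proof. by move=> X2 Y2; rewrite subfunE; apply: L2D => //; exact: L2Z. Qed.

Lemma innerDl X Y Z : L2 P X -> L2 P Y -> L2 P Z ->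
  inner P (X \+ Y) Z = inner P X Z + inner P Y Z.
Proof.
move=> X2 Y2 Z2; rewrite /inner -cintegralD//; try exact: cintegrable_inner.
by congr cintegral; apply/funext => w /=; rewrite mulrDl.
Qed.

Lemma innerZl c X Z : L2 P X -> L2 P Z ->
  inner P (c \*o X) Z = c * inner P X Z.
Proof.
move=> X2 Z2; rewrite /inner -cintegralZ//; last exact: cintegrable_inner.
by congr cintegral; apply/funext => w /=; rewrite mulrA.
Qed.

Lemma innerC X Y : L2 P X -> L2 P Y -> inner P Y X = (inner P X Y)^*.
Proof.
move=> X2 Y2; rewrite /inner -cintegral_conj; last exact: cintegrable_inner.
by congr cintegral; apply/funext => w; rewrite rmorphM/= conjcK mulrC.
Qed.

Lemma innerDr X Y Z : L2 P X -> L2 P Y -> L2 P Z ->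
  inner P Z (X \+ Y) = inner P Z X + inner P Z Y.
Proof.
move=> X2 Y2 Z2; rewrite (innerC (L2D X2 Y2) Z2) innerDl//.
by rewrite (innerC X2 Z2) (innerC Y2 Z2) rmorphD.
Qed.

Lemma innerZr c X Z : L2 P X -> L2 P Z ->
  inner P Z (c \*o X) = c^*%C * inner P Z X.
Proof.
move=> X2 Z2; rewrite (innerC (L2Z c X2) Z2) innerZl//.
by rewrite (innerC X2 Z2) rmorphM.
Qed.

Lemma innerBl X Y Z : L2 P X -> L2 P Y -> L2 P Z ->
  inner P (X \- Y) Z = inner P X Z - inner P Y Z.
Proof.
by move=> *; rewrite subfunE innerDl ?innerZl ?mulN1r//; exact: L2Z.
Qed.

Lemma innerBr X Y Z : L2 P X -> L2 P Y -> L2 P Z ->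
  inner P Z (X \- Y) = inner P Z X - inner P Z Y.
Proof.
move=> *; rewrite subfunE innerDr ?innerZr//; last exact: L2Z.
by rewrite rmorphN rmorph1 mulN1r.
Qed.

Lemma inner0l Z : inner P (fun=> 0) Z = 0.
Proof. by rewrite /inner; under eq_fun do rewrite mul0r; exact: cintegral0. Qed.

Lemma nrm2E X : nrm2 X = \int[P]_w (normc (X w) ^+ 2).
Proof. by rewrite /nrm2 /=; apply: eq_Rintegral => w _; rewrite mulJE. Qed.

Lemma nrm2_ge0 X : 0 <= nrm2 X.
Proof. by rewrite nrm2E; apply: Rintegral_ge0 => w _; exact: sqr_ge0. Qed.

Lemma second_momentE X : L2 P X -> second_moment P X = (nrm2 X)%:E.
Proof.
move=> /L2P[_ X2]; rewrite nrm2E fineK//.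
exact: integrable_fin_num.
Qed.

Lemma inner_nrm2 X : L2 P X -> inner P X X = (nrm2 X)%:C.
Proof.
move=> X2; have := innerC X2 X2; rewrite /nrm2.
case: (inner P X X) => a b /= [/eqP]; rewrite -addr_eq0 -mulr2n.
by rewrite mulrn_eq0/= => /eqP ->.
Qed.

Lemma nrm2D X Y : L2 P X -> L2 P Y ->
  nrm2 (X \+ Y) = nrm2 X + nrm2 Y + 2 * complex.Re (inner P X Y).
Proof.
move=> X2 Y2; rewrite /nrm2 innerDl ?innerDr//; last exact: L2D.
by rewrite (innerC X2 Y2) !cReD cReJ; ring.
Qed.

Lemma nrm2Z c X : L2 P X -> nrm2 (c \*o X) = normc c ^+ 2 * nrm2 X.
Proof.
move=> X2; rewrite /nrm2 innerZl ?innerZr//; last exact: L2Z.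
by rewrite inner_nrm2// mulrA mulJE cReM /= mulr0 subr0.
Qed.

Lemma nrm2B X Y : L2 P X -> L2 P Y ->
  nrm2 (X \- Y) = nrm2 X + nrm2 Y - 2 * complex.Re (inner P X Y).
Proof.
move=> X2 Y2; rewrite subfunE nrm2D ?nrm2Z ?innerZr//; try exact: L2Z.
by rewrite rmorphN rmorph1 mulN1r normc2E; case: (inner _ _ _) => a b /=; ring.
Qed.

Lemma nrm2BC X Y : nrm2 (X \- Y) = nrm2 (Y \- X).
Proof.
rewrite !nrm2E; apply: eq_Rintegral => w _ /=.
by rewrite !normc2E !cReB !cImB; ring.
Qed.

Lemma parallelogram X Y : L2 P X -> L2 P Y ->
  nrm2 (X \+ Y) + nrm2 (X \- Y) = 2 * nrm2 X + 2 * nrm2 Y.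
Proof. by move=> X2 Y2; rewrite nrm2D// nrm2B//; ring. Qed.

Lemma nrm2D_le X Y : L2 P X -> L2 P Y ->
  nrm2 (X \+ Y) <= 2 * nrm2 X + 2 * nrm2 Y.
Proof.
by move=> X2 Y2; rewrite -parallelogram// lerDl nrm2_ge0.
Qed.

Lemma nrm2B_triangle X Y Z : L2 P X -> L2 P Y -> L2 P Z ->
  nrm2 (X \- Z) <= 2 * nrm2 (X \- Y) + 2 * nrm2 (Y \- Z).
Proof.
move=> X2 Y2 Z2; rewrite (_ : X \- Z = (X \- Y) \+ (Y \- Z)).
  by apply: nrm2D_le; exact: L2B.
by apply/funext => w /=; rewrite subrKA.
Qed.

(** Moving [X] along [Y] by a suboptimal step already lowers the norm in
    proportion to [|<X, Y>|^2]. The step is [<X, Y> / (1 + |Y|^2)] instead of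
    the optimal [<X, Y> / |Y|^2], so that [Y = 0] is no special case. *)
Lemma nrm2_descent X Y (c := ((1 + nrm2 Y)^-1)%:C * inner P X Y) :
  L2 P X -> L2 P Y ->
  normc (inner P X Y) ^+ 2 <= (1 + nrm2 Y) * (nrm2 X - nrm2 (X \- (c \*o Y))).
Proof.
move=> X2 Y2; rewrite {}/c; set m := inner P X Y; set N := nrm2 Y.
have N0 : 0 <= N := nrm2_ge0 Y.
set s := (1 + N)^-1; have s0 : 0 < s by rewrite invr_gt0 ltr_wpDr.
have sN : s * (1 + N) = 1 by rewrite mulVf// gt_eqF// ltr_wpDr.
rewrite nrm2B ?nrm2Z ?innerZr//; try exact: L2Z.
rewrite -/m -/N normcM2 normc2_real.
have -> : (s%:C * m)^*%C * m = (s * normc m ^+ 2)%:C.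
  by rewrite conjc_realM -mulrA (mulrC _ m) mulJE -rmorphM.
move: (normc m ^+ 2) (sqr_ge0 (normc m)) => q q0 /=.
rewrite -(ler_pM2l s0) [leRHS]mulrA sN mul1r.
have sq : s * s * q + s * s * N * q = s * (s * (1 + N)) * q by ring.
rewrite sN mulr1 in sq.
have : 0 <= s * s * q by rewrite !mulr_ge0// ltW.
by rewrite expr2; lra.
Qed.

(** Cauchy-Schwarz up to a constant, which is all that the continuity of the
    inner product requires. *)
Lemma inner_bound X Y : L2 P X -> L2 P Y ->
  normc (inner P X Y) ^+ 2 <= (1 + nrm2 Y) * nrm2 X.
Proof.
move=> X2 Y2; apply: le_trans (nrm2_descent X2 Y2) _.
by rewrite ler_pM2l ?gerBl ?nrm2_ge0// ltr_wpDr// nrm2_ge0.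
Qed.

Lemma nrm2_inner0 X Y : L2 P X -> L2 P Y -> nrm2 X = 0 -> inner P X Y = 0.
Proof.
move=> X2 Y2 X0; have := inner_bound X2 Y2; rewrite X0 mulr0 => H.
have /eqP : normc (inner P X Y) ^+ 2 = 0 by apply/eqP; rewrite eq_le H sqr_ge0.
by rewrite sqrf_eq0 => /eqP /ComplexField.Normc.eq0_normc.
Qed.

Lemma as_eq_nrm2 X Y : L2 P X -> L2 P Y -> as_eq P X Y -> nrm2 (X \- Y) = 0.
Proof.
move=> X2 Y2 XY; have /L2P[mXY _] := L2B X2 Y2.
rewrite nrm2E /Rintegral (ae_eq_integral (cst 0%E)) ?integral0//.
  exact/measurable_EFinP/measurable_normc2.
by apply: filterS XY => w /= -> _; rewrite subrr normc2E /= expr0n addr0.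
Qed.

End PreHilbert.

(** * Completeness of the space of square-integrable variables *)

Section Completeness.
Context (R : realType) (d : measure_display) (T : measurableType d).
Implicit Types (u : nat -> T -> R).

Lemma half_sum_le k : \sum_(0 <= i < k) (2^-1 : R) ^+ i <= 2.
Proof.
suff -> : \sum_(0 <= i < k) (2^-1 : R) ^+ i = 2 - 2 * 2^-1 ^+ k.
  by rewrite gerBl mulr_ge0// exprn_ge0.
elim: k => [|k IH]; first by rewrite big_nil expr0 mulr1 subrr.
rewrite big_nat_recr//= IH exprS.
by move: (2^-1 ^+ k) => x; field.
Qed.

Lemma nneseries_half_le (f : nat -> \bar R) :
  (forall i, (0 <= f i)%E) -> (forall i, (f i <= ((2^-1) ^+ i)%:E)%E) ->
  (\sum_(0 <= i <oo) f i <= 2%:E)%E.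
Proof.
move=> f0 fle; apply: lime_le; first by apply: is_cvg_nneseries => *; exact: f0.
apply: nearW => k; apply: (@le_trans _ _ (\sum_(0 <= i < k) (2^-1 ^+ i)%:E)%E).
  exact: lee_sum.
by rewrite sumEFin lee_fin half_sum_le.
Qed.

Variable mu : {measure set T -> \bar R}.

Let sq (f : T -> R) := (\int[mu]_x (f x ^+ 2)%:E)%E.

Let measurable_sq (f : T -> R) : measurable_fun setT f ->
  measurable_fun setT (fun x => (f x ^+ 2)%:E : \bar R).
Proof. by move=> mf; apply/measurable_EFinP; exact: measurable_funX. Qed.

(** If the increments [D n] of a sequence satisfy [|D n|^2 <= 4 ^- n] in mean,
    then [g = \sum 2 ^+ n * (D n) ^+ 2] is integrable, and where [g] is finite
    [\sum |D n|] converges because [|D n| <= 2 ^- n + 2 ^+ n * (D n) ^+ 2]. *)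
Lemma fast_cauchy_ae_cvg u : (forall n, measurable_fun setT (u n)) ->
  (forall n, (sq (u n.+1 \- u n)%R <= (4^-1 ^+ n)%:E)%E) ->
  {ae mu, forall x, cvgn (u ^~ x)}.
Proof.
move=> mu_ ucau.
pose g n x := ((2 ^+ n)%:E * ((u n.+1 x - u n x) ^+ 2)%:E)%E : \bar R.
have mg n : measurable_fun setT (g n).
  apply: measurable_funeM; apply: measurable_sq; exact: measurable_funB.
have g0 n x : (0 <= g n x)%E by rewrite /g -EFinM lee_fin mulr_ge0// sqr_ge0.
pose G x := (\sum_(0 <= n <oo) g n x)%E.
have mG : measurable_fun setT G.
  by apply: ge0_emeasurable_sum => *; [exact: g0|exact: mg].
have G0 x : (0 <= G x)%E by apply: nneseries_ge0 => *; exact: g0.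
have iG : mu.-integrable setT G.
  apply/integrableP; split => //.
  under eq_integral do rewrite gee0_abs//.
  rewrite (integral_nneseries mu measurableT mg (fun n x _ => g0 n x)).
  apply: (@le_lt_trans _ _ 2%:E); last by rewrite ltry.
  apply: nneseries_half_le => n; first by apply: integral_ge0 => *; exact: g0.
  rewrite ge0_integralZl//; last 2 first.
  - by apply: measurable_sq; exact: measurable_funB.
  - by move=> *; rewrite lee_fin sqr_ge0.
  apply: (@le_trans _ _ ((2 ^+ n)%:E * (4^-1 ^+ n)%:E)%E).
    by apply: lee_wpmul2l; [rewrite lee_fin|exact: ucau].
  by rewrite -EFinM lee_fin -exprMn (_ : 2 * 4^-1 = 2^-1)//; field.
have := integrable_ae measurableT iG; apply: filterS => x /(_ I) Gx.
have -> : u ^~ x = (fun n => u 0 x + series (fun k => u k.+1 x - u k x) n).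
  by apply/funext => n; rewrite seriesEnat/= telescope_sumr// addrC subrK.
apply: is_cvgD; first exact: is_cvg_cst.
apply: normed_cvg; apply: nondecreasing_is_cvgn.
  apply: nondecreasing_series => *; exact: normr_ge0.
exists (2 + fine (G x)) => _ [n _ <-].
rewrite /normed_series_of seriesEnat/=.
apply: (@le_trans _ _ (\sum_(0 <= k < n) (2^-1 ^+ k + fine (g k x)))).
  apply: ler_sum => k _; rewrite /g -EFinM/=.
  set e := u k.+1 x - u k x.
  have a0 : 0 < 2 ^+ k :> R by rewrite exprn_gt0.
  rewrite exprVn -(real_normK (num_real e)).
  move: `|e| (normr_ge0 e) => {}e e0.
  rewrite -(ler_pM2l a0) mulrDr divff ?gt_eqF//.
  move: (2 ^+ k) a0 => a a0.
  by have := sqr_ge0 (a * e - 1); have := mulr_ge0 (ltW a0) e0; nra.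
rewrite big_split/= lerD ?half_sum_le// -lee_fin fineK//.
rewrite -sumEFin.
by apply: le_trans (@nneseries_lim_ge _ (g ^~ x) xpredT 0 n _).
Qed.

(** The limit of a sequence that converges only almost everywhere is made
    measurable by cutting it off to 0 outside a measurable set of full
    measure, and Fatou's lemma bounds its distance to the sequence. *)
Lemma fast_cauchy_real_cvg u : (forall n, measurable_fun setT (u n)) ->
  (forall n m, (n <= m)%N -> (sq (u m \- u n)%R <= (4^-1 ^+ n)%:E)%E) ->
  exists v : T -> R, measurable_fun setT v /\
    forall n, (sq (v \- u n)%R <= (4^-1 ^+ n)%:E)%E.
Proof.
move=> mu_ ucau.
have [N [mN N0 Nsub]] := fast_cauchy_ae_cvg mu_ (fun n => ucau _ _ (leqnSn n)).
have ucvg x : ~ N x -> cvgn (u ^~ x).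
  by move=> Nx; apply: contrapT => H; exact/Nx/Nsub.
pose w n x := u n x * \1_(~` N) x.
have mw n : measurable_fun setT (w n).
  apply: measurable_funM => //; apply: measurable_indic; exact: measurableC.
have wE n x : ~ N x -> w n x = u n x.
  by move=> Nx; rewrite /w indicE mem_set// mulr1.
have wcvg x : cvgn (w ^~ x).
  have [Nx|Nx] := pselect (N x); last first.
    by rewrite (_ : w ^~ x = u ^~ x); [exact: ucvg|apply/funext => n;
      exact: wE].
  rewrite (_ : w ^~ x = fun=> 0); first exact: is_cvg_cst.
  by apply/funext => n; rewrite /w indicE memNset ?mulr0//= => /(_ Nx).
pose v x := limn (w ^~ x).
have mv : measurable_fun setT v.
  by apply: (@measurable_fun_cvg _ _ _ setT w) => // x _; exact: wcvg.
exists v; split => // n.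
pose f m x := ((u (m + n)%N x - u n x) ^+ 2)%:E : \bar R.
have mf m : measurable_fun setT (f m).
  by apply: measurable_sq; exact: measurable_funB.
have f0 m x : (0 <= f m x)%E by rewrite lee_fin sqr_ge0.
have fE x : ~ N x -> limn_einf (f ^~ x) = ((v x - u n x) ^+ 2)%:E.
  move=> Nx.
  have uv : u (m + n)%N x @[m --> \oo] --> v x.
    rewrite (_ : (fun m => u (m + n)%N x) = fun m => w (m + n)%N x).
      by rewrite (cvg_shiftn n (w ^~ x)); exact: wcvg.
    by apply/funext => m; rewrite wE.
  have fcvg : f ^~ x @ \oo --> ((v x - u n x) ^+ 2)%:E.
    apply: cvg_EFin; first exact: nearW.
    rewrite (_ : fine \o f ^~ x =
      (fun m => (u (m + n)%N x - u n x) * (u (m + n)%N x - u n x)))//.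
    have uB : u (m + n)%N x - u n x @[m --> \oo] --> v x - u n x.
      by apply: cvgB => //; exact: cvg_cst.
    by rewrite expr2; exact: cvgM.
  rewrite is_cvg_limn_einfE; first exact/cvg_lim.
  by apply/cvg_ex; eexists; exact: fcvg.
rewrite /sq (@ge0_ae_eq_integral _ _ _ _ setT _ (fun x => limn_einf (f ^~ x)))
  //.
- apply: (le_trans (fatou mu measurableT mf (fun m x _ => f0 m x))).
  rewrite limn_einf_lim; apply: lime_le; first exact: is_cvg_einfs.
  apply: nearW => k; apply: (@le_trans _ _ (\int[mu]_x f k x)%E).
    by apply: ereal_inf_lbound; exists k => //=.
  by apply: ucau; rewrite leq_addl.
- by apply: measurable_sq; exact: measurable_funB.
- apply: (emeasurable_fun_cvg (fun k x => einfs (f ^~ x) k)).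
    by move=> k; exact: measurable_fun_einfs.
  by move=> x _; rewrite limn_einf_lim; exact: is_cvg_einfs.
- by move=> x _; rewrite lee_fin sqr_ge0.
- move=> x _; rewrite limn_einf_lim; apply: lime_ge; first exact: is_cvg_einfs.
  by apply: nearW => k; apply: le_ereal_inf_tmp => _ [m _ <-]; exact: f0.
- exists N; split => // x /= H; apply: contrapT => Nx; apply: H => _.
  by rewrite fE.
Qed.

End Completeness.

Section L2Completeness.
Context (R : realType) (d : measure_display) (T : measurableType d).
Variable P : probability T R.

Lemma L2_fast_cauchy_cvg (X : nat -> T -> R[i]) : (forall n, L2 P (X n)) ->
  (forall n m, (n <= m)%N -> nrm2 P (X m \- X n) <= 4^-1 ^+ n) ->
  exists Z, L2 P Z /\ forall n, nrm2 P (Z \- X n) <= 2 * 4^-1 ^+ n.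
Proof.
move=> X2 Xcau.
have mX n : cmeasurable (X n) by have [] := X2 n.
have part (f : R[i] -> R) : (forall x y, f (x - y) = f x - f y) ->
    (forall x, f x ^+ 2 <= normc x ^+ 2) ->
    (forall Y : T -> R[i], cmeasurable Y -> measurable_fun setT (f \o Y)) ->
    exists v : T -> R, measurable_fun setT v /\ forall n,
      (\int[P]_w ((v w - f (X n w)) ^+ 2)%:E <= (4^-1 ^+ n)%:E)%E.
  move=> fB fle mf; apply: (@fast_cauchy_real_cvg _ _ _ P (fun n => f \o X n)).
    by move=> n; exact: mf (mX n).
  move=> n m nm; apply: (@le_trans _ _ (second_moment P (X m \- X n)%R));
    last first.
    by rewrite second_momentE ?lee_fin ?Xcau//; exact: L2B.
  have mB : cmeasurable (X m \- X n) by have [] := L2B (X2 m) (X2 n).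
  apply: ge0_le_integral => //.
  - by move=> w _; rewrite lee_fin sqr_ge0.
  - apply/measurable_EFinP; apply: measurable_funX.
    by apply: measurable_funB; exact: mf.
  - by apply/measurable_EFinP/measurable_normc2.
  - by move=> w _; rewrite lee_fin /= -fB.
have [||a [ma Xa]] := part (@complex.Re R) (@cReB R).
- by move=> x; rewrite normc2E lerDl sqr_ge0.
- by move=> Y [].
have [||b [mb Xb]] := part (@complex.Im R) (@cImB R).
- by move=> x; rewrite normc2E lerDr sqr_ge0.
- by move=> Y [].
pose Z w := a w +i* b w.
have ZX n : (second_moment P (Z \- X n)%R <= (2 * 4^-1 ^+ n)%:E)%E.
  have [mr mi] := mX n.
  rewrite /second_moment; under eq_integral do rewrite normc2E cReB cImB EFinD.
  rewrite ge0_integralD//=.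
  - by rewrite mulr2n mulrDl mul1r EFinD leeD.
  - by move=> w _; rewrite lee_fin sqr_ge0.
  - by apply/measurable_EFinP/measurable_funX/measurable_funB.
  - by move=> w _; rewrite lee_fin sqr_ge0.
  - by apply/measurable_EFinP/measurable_funX/measurable_funB.
have ZX2 n : L2 P (Z \- X n).
  split; last exact: le_lt_trans (ZX n) (ltry _).
  by rewrite subfunE; apply: cmeasurableD => //; exact: cmeasurableZ.
exists Z; split.
  rewrite (_ : Z = (Z \- X 0%N) \+ X 0%N); first exact: L2D.
  by apply/funext => w /=; rewrite subrK.
by move=> n; rewrite -lee_fin -second_momentE.
Qed.

End L2Completeness.

(** * Closed linear spans and orthogonal projections *)

Section Span.
Context (R : realType) (d : measure_display) (T : measurableType d).
Variable P : probability T R.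
Implicit Types (X Y Z W : T -> R[i]) (G K : set (T -> R[i])).

Lemma lin_span_ind G K : K (fun=> 0) ->
  (forall X Y, K X -> K Y -> K (X \+ Y)) -> (forall c X, K X -> K (c \*o X)) ->
  G `<=` K -> lin_span G `<=` K.
Proof.
move=> K0 KD KZ GK _ [n [c [g [Gg ->]]]].
elim: n c g Gg => [|n IH] c g Gg.
  by rewrite (_ : (fun _ => _) = fun=> 0)//; apply/funext => w;
    rewrite big_ord0.
rewrite (_ : (fun w => _) = (c ord0 \*o g ord0) \+
    (fun w => \sum_(i < n) c (lift ord0 i) * g (lift ord0 i) w)); last first.
  by apply/funext => w; rewrite big_ord_recl.
by apply: KD; [exact/KZ/GK|apply: (IH (c \o lift ord0) (g \o lift ord0)) => i;
  exact: Gg].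
Qed.

Lemma lin_span0 G : lin_span G (fun=> 0).
Proof.
exists 0%N, (fun=> 0), (fun=> fun=> 0); split; first by case.
by apply/funext => w; rewrite big_ord0.
Qed.

Lemma lin_span_cons G c X Y : G X -> lin_span G Y -> lin_span G (c \*o X \+ Y).
Proof.
move=> GX [n [e [g [Gg ->]]]].
exists n.+1, (fun i => oapp e c (unlift ord0 i)), (fun i => oapp g X (unlift
  ord0 i)).
split; first by move=> i; case: unliftP => [j|] _ /=.
apply/funext => w; rewrite big_ord_recl /= !unlift_none/=; congr (_ + _).
by apply: eq_bigr => i _; rewrite !liftK.
Qed.

Lemma lin_spanZ G c X : lin_span G X -> lin_span G (c \*o X).
Proof.
move=> [n [e [g [Gg ->]]]]; exists n, (fun i => c * e i), g; split => //.
by apply/funext => w /=; rewrite mulr_sumr; apply: eq_bigr => i _;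
  rewrite mulrA.
Qed.

Lemma lin_spanD G X Y : lin_span G X -> lin_span G Y -> lin_span G (X \+ Y).
Proof.
move=> [n [c [g [Gg ->]]]] GY; elim: n c g Gg => [|n IH] c g Gg.
  by rewrite (_ : _ \+ _ = Y)//; apply/funext => w /=; rewrite big_ord0 add0r.
rewrite (_ : _ \+ _ = c ord0 \*o g ord0 \+
    ((fun w => \sum_(i < n) c (lift ord0 i) * g (lift ord0 i) w) \+ Y)).
  apply: lin_span_cons => //.
  by apply: (IH (c \o lift ord0) (g \o lift ord0)) => i; exact: Gg.
by apply/funext => w /=; rewrite big_ord_recl addrA.
Qed.

Lemma lin_span_mem G X : G X -> lin_span G X.
Proof.
move=> GX; have := lin_span_cons 1 GX (lin_span0 G).
by congr lin_span; apply/funext => w /=; rewrite mul1r addr0.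
Qed.

Lemma lin_spanS G G' : G `<=` G' -> lin_span G `<=` lin_span G'.
Proof.
move=> GG'; apply: lin_span_ind; first exact: lin_span0.
- exact: lin_spanD.
- exact: lin_spanZ.
- by move=> X /GG'; exact: lin_span_mem.
Qed.

Lemma lin_span_L2 G : G `<=` L2 P -> lin_span G `<=` L2 P.
Proof.
apply: lin_span_ind; [exact: L2_0|exact: L2D|move=> *; exact: L2Z].
Qed.

Lemma closed_spanS G G' : G `<=` G' -> closed_span P G `<=` closed_span P G'.
Proof.
move=> GG' X [X2 XG]; split => // e /XG[Z [GZ Ze]].
by exists Z; split => //; exact: lin_spanS GZ.
Qed.

Lemma closed_span_L2 G : closed_span P G `<=` L2 P.
Proof. by move=> X []. Qed.

Section L2Generators.
Variable G : set (T -> R[i]).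
Hypothesis G2 : G `<=` L2 P.
Let L := closed_span P G.

Lemma closed_spanP X : L X <-> L2 P X /\ forall e : R, 0 < e ->
  exists Z, lin_span G Z /\ nrm2 P (X \- Z) < e.
Proof.
split=> -[X2 XG]; split => // e /XG[Z [GZ Ze]]; exists Z; split => //.
  by rewrite -lte_fin -second_momentE//; apply: L2B => //;
    exact: lin_span_L2 GZ.
by rewrite second_momentE//; apply: L2B => //; exact: lin_span_L2 GZ.
Qed.

Lemma nrm2_subrr X : nrm2 P (X \- X) = 0.
Proof.
rewrite nrm2E; under eq_Rintegral do rewrite /= subrr normc2E/= expr0n addr0.
by rewrite Rintegral_cst// mul0r.
Qed.

Lemma closed_span_span : lin_span G `<=` L.
Proof.
move=> X GX; apply/closed_spanP; split; first exact: lin_span_L2 GX.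
by move=> e e0; exists X; rewrite nrm2_subrr.
Qed.

Lemma closed_span_mem : G `<=` L.
Proof. by move=> X GX; exact/closed_span_span/lin_span_mem. Qed.

Lemma closed_span0 : L (fun=> 0).
Proof. exact/closed_span_span/lin_span0. Qed.

Lemma closed_spanD X Y : L X -> L Y -> L (X \+ Y).
Proof.
move=> /closed_spanP[X2 XG] /closed_spanP[Y2 YG].
apply/closed_spanP; split; first exact: L2D.
move=> e e0; have e4 : 0 < e / 4 by rewrite divr_gt0.
have [U [GU XU]] := XG _ e4; have [V [GV YV]] := YG _ e4.
have [U2 V2] := (lin_span_L2 G2 GU, lin_span_L2 G2 GV).
exists (U \+ V); split; first exact: lin_spanD.
rewrite (_ : (_ \- _) = (X \- U) \+ (Y \- V)); last first.
  by apply/funext => w /=; rewrite opprD addrACA.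
apply: le_lt_trans (nrm2D_le (L2B X2 U2) (L2B Y2 V2)) _.
by lra.
Qed.

Lemma closed_spanZ c X : L X -> L (c \*o X).
Proof.
move=> /closed_spanP[X2 XG]; apply/closed_spanP; split; first exact: L2Z.
move=> e e0; have c0 : 0 < 1 + normc c ^+ 2 by rewrite ltr_wpDr// sqr_ge0.
have [U [GU XU]] := XG _ (divr_gt0 e0 c0); have U2 := lin_span_L2 G2 GU.
exists (c \*o U); split; first exact: lin_spanZ.
rewrite (_ : (_ \- _) = c \*o (X \- U)); last first.
  by apply/funext => w /=; rewrite mulrBr.
rewrite nrm2Z; last exact: L2B.
move: XU; rewrite ltr_pdivlMr// => XU; apply: le_lt_trans XU.
by rewrite mulrDr mulr1 mulrC lerDr nrm2_ge0.
Qed.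

Lemma closed_spanB X Y : L X -> L Y -> L (X \- Y).
Proof.
by move=> LX LY; rewrite subfunE; apply: closed_spanD => //;
  exact: closed_spanZ.
Qed.

Lemma closed_span_lim X : L2 P X ->
  (forall e : R, 0 < e -> exists Z, L Z /\ nrm2 P (X \- Z) < e) -> L X.
Proof.
move=> X2 XL; apply/closed_spanP; split => // e e0.
have e4 : 0 < e / 4 by rewrite divr_gt0.
have [Z [/closed_spanP[Z2 ZG] XZ]] := XL _ e4; have [U [GU ZU]] := ZG _ e4.
exists U; split => //; have U2 := lin_span_L2 G2 GU.
by apply: le_lt_trans (nrm2B_triangle X2 Z2 U2) _; lra.
Qed.

Lemma closed_span_nrm2 X Y : L Y -> L2 P X -> nrm2 P (X \- Y) = 0 -> L X.
Proof. by move=> LY X2 XY; apply: closed_span_lim => // e e0; exists Y;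
  rewrite XY. Qed.

Lemma closed_span_orth V : L2 P V -> (forall g, G g -> inner P g V = 0) ->
  forall X, L X -> inner P X V = 0.
Proof.
move=> V2 GV X LX; have X2 := closed_span_L2 LX.
have spanV Z : lin_span G Z -> inner P Z V = 0.
  move=> GZ; suff [] : (L2 P `&` [set Z | inner P Z V = 0]) Z by [].
  move: Z GZ; apply: lin_span_ind.
  - by split; [exact: L2_0|exact: inner0l].
  - by move=> A B [A2 A0] [B2 B0]; split;
    [exact: L2D|rewrite /= innerDl// A0 B0 addr0].
  - by move=> c A [A2 A0]; split; [exact: L2Z|rewrite /= innerZl// A0 mulr0].
  - by move=> Z GZ; split; [exact: G2|exact: GV].
have /closed_spanP[_ XG] := LX.
apply: ComplexField.Normc.eq0_normc; apply/eqP;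
  rewrite -sqrf_eq0 eq_le sqr_ge0 andbT.
have N0 : 0 < 1 + nrm2 P V by rewrite ltr_wpDr// nrm2_ge0.
apply/ler_addgt0Pl => e e0; rewrite addr0.
have [Z [GZ XZ]] := XG _ (divr_gt0 e0 N0).
have Z2 := lin_span_L2 G2 GZ.
have -> : inner P X V = inner P (X \- Z) V by rewrite innerBl// (spanV _ GZ)
  subr0.
apply: le_trans (inner_bound (L2B X2 Z2) V2) _.
by rewrite mulrC -ler_pdivlMr// ltW.
Qed.

Lemma le0_geometric (x C : R) : (forall n, x <= C * 4^-1 ^+ n) -> x <= 0.
Proof.
move=> xC; have C0 : (fun n => C * 4^-1 ^+ n : R) @ \oo --> (0 : R).
  by apply: cvg_geometric; rewrite ger0_norm ?invr_ge0// invf_lt1// ltr1n.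
rewrite -(cvg_lim (@Rhausdorff R) C0); apply: limr_ge.
  by apply/cvg_ex; exists 0.
exact: nearW.
Qed.

(** The projection is the limit of a minimizing sequence: the parallelogram law
    makes the sequence Cauchy, and since a step along [W] cannot lower the
    distance below the infimum, [nrm2_descent] bounds [<X - Z_ n, W>]. *)
Lemma ortho_proj_ex X : L2 P X ->
  exists Z, L Z /\ forall W, L W -> inner P (X \- Z) W = 0.
Proof.
move=> X2; pose D := [set nrm2 P (X \- Z) | Z in L].
have D0 : D !=set0 by exists (nrm2 P (X \- (fun=> 0))), (fun=> 0) => //;
  exact: closed_span0.
have Dlb : has_lbound D by exists 0 => _ [Z _ <-]; exact: nrm2_ge0.
have infD Z : L Z -> inf D <= nrm2 P (X \- Z).
  by move=> LZ; apply: ge_inf => //; exists Z.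
(* The parallelogram law bounds |Z_ m - Z_ n|^2 by four times the larger of
   their excesses over the infimum, hence the factor 1/4. *)
have /choice[Z_ HZ] : forall n, exists Z, L Z /\
    nrm2 P (X \- Z) < inf D + 4^-1 * 4^-1 ^+ n.
  move=> n; have e0 : 0 < 4^-1 * 4^-1 ^+ n :> R by rewrite mulr_gt0// exprn_gt0.
  by have [_ [Z LZ <-] Ze] := inf_adherent e0 (conj D0 Dlb); exists Z.
have LZ n : L (Z_ n) by have [] := HZ n.
have Z2 n : L2 P (Z_ n) := closed_span_L2 (LZ n).
have XZ n : nrm2 P (X \- Z_ n) < inf D + 4^-1 * 4^-1 ^+ n by have [] := HZ n.
have cau n m : (n <= m)%N -> nrm2 P (Z_ m \- Z_ n) <= 4^-1 ^+ n.
  move=> nm; have := parallelogram (L2B X2 (Z2 n)) (L2B X2 (Z2 m)).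
  pose M := 2^-1 \*o (Z_ m \+ Z_ n).
  have LM : L M by apply/closed_spanZ/closed_spanD.
  rewrite (_ : (X \- Z_ n) \- (X \- Z_ m) = Z_ m \- Z_ n); last first.
    by apply/funext => w /=; ring.
  rewrite (_ : (X \- Z_ n) \+ (X \- Z_ m) = 2 \*o (X \- M)); last first.
    by apply/funext => w; rewrite /M /=; field.
  rewrite nrm2Z; last by apply: L2B => //; exact: closed_span_L2 LM.
  rewrite (normc2E 2)/= add0r expr0n addr0.
  have := infD _ LM; have := XZ n; have := XZ m.
  have : 4^-1 ^+ m <= 4^-1 ^+ n :> R.
    by apply: ler_wiXn2l; rewrite ?invr_ge0// invf_le1// ler1n.
  move: (4^-1 ^+ m) (4^-1 ^+ n) (nrm2 P (X \- M)) => p q r.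
  by move: (nrm2 P _) (nrm2 P _) (nrm2 P _) => a b c; lra.
have [Z [ZL2 ZZ]] := L2_fast_cauchy_cvg Z2 cau.
have LZlim : L Z.
  apply: closed_span_lim => // e e0; apply: contrapT => H.
  have : e <= 0; last by rewrite leNgt e0.
  apply: (@le0_geometric _ 2) => n; apply: le_trans (ZZ n).
  by rewrite leNgt; apply/negP => He; apply: H; exists (Z_ n).
exists Z; split => // W LW; have W2 := closed_span_L2 LW.
apply: ComplexField.Normc.eq0_normc; apply/eqP;
  rewrite -sqrf_eq0 eq_le sqr_ge0 andbT.
apply: (@le0_geometric _ (6 * (1 + nrm2 P W))) => n.
rewrite (_ : X \- Z = (X \- Z_ n) \+ (Z_ n \- Z)); last first.
  by apply/funext => w /=; rewrite subrKA.
rewrite innerDl//; try exact: L2B.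
apply: le_trans (normcD2_le _ _) _.
have N0 : 0 < 1 + nrm2 P W by rewrite ltr_wpDr// nrm2_ge0.
have H1 := inner_bound (L2B (Z2 n) ZL2) W2.
have H2 := nrm2_descent (L2B X2 (Z2 n)) W2.
set c := (_%:C * _) in H2.
have H3 : inf D <= nrm2 P ((X \- Z_ n) \- (c \*o W)).
  rewrite (_ : _ \- _ \- _ = X \- (Z_ n \+ (c \*o W))).
    by apply: infD; apply: closed_spanD => //; exact: closed_spanZ.
  by apply/funext => w /=; ring.
have H4 : nrm2 P (X \- Z_ n) - nrm2 P ((X \- Z_ n) \- (c \*o W)) <= 4^-1 * 4^-1
  ^+ n.
  by have := XZ n; lra.
have H5 := le_trans H2 (ler_wpM2l (ltW N0) H4).
have H6 : nrm2 P (Z_ n \- Z) <= 2 * 4^-1 ^+ n by rewrite nrm2BC.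
have H7 := le_trans H1 (ler_wpM2l (ltW N0) H6).
have H8 : 0 <= (1 + nrm2 P W) * 4^-1 ^+ n by rewrite mulr_ge0 ?exprn_ge0// ltW.
move: H5 H7 H8; move: (normc _ ^+ 2) (normc _ ^+ 2) (nrm2 P W) (4^-1 ^+ n) =>
  *; lra.
Qed.

Let Pr := ortho_proj P L.

Lemma ortho_projP X : L2 P X ->
  L (Pr X) /\ forall W, L W -> inner P (X \- Pr X) W = 0.
Proof.
move=> /ortho_proj_ex XZ.
exact: (@xgetPex _ (fun=> 0)
  [set Z | L Z /\ forall W, L W -> inner P (X \- Z) W = 0] XZ).
Qed.

Lemma ortho_proj_in X : L2 P X -> L (Pr X).
Proof. by move=> /ortho_projP[]. Qed.

Lemma ortho_proj_L2 X : L2 P X -> L2 P (Pr X).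
Proof. by move=> /ortho_proj_in /closed_span_L2. Qed.

Lemma ortho_proj_orth X W : L2 P X -> L W -> inner P (X \- Pr X) W = 0.
Proof. by move=> /ortho_projP[_]; exact. Qed.

Lemma ortho_proj_orthr X W : L2 P X -> L W -> inner P W (X \- Pr X) = 0.
Proof.
move=> X2 LW; rewrite (@innerC _ _ _ P (X \- Pr X) W) ?ortho_proj_orth
  ?conjc0//.
  by apply: L2B => //; exact: ortho_proj_L2.
exact: closed_span_L2 LW.
Qed.

Lemma ortho_proj_unique X Z : L2 P X -> L Z ->
  (forall W, L W -> inner P (X \- Z) W = 0) -> nrm2 P (Z \- Pr X) = 0.
Proof.
move=> X2 LZ XZ; have Z2 := closed_span_L2 LZ; have P2 := ortho_proj_L2 X2.
have LZP : L (Z \- Pr X) by apply: closed_spanB => //; exact: ortho_proj_in.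
have -> : nrm2 P (Z \- Pr X) =
    complex.Re (inner P (X \- Pr X) (Z \- Pr X) - inner P (X \- Z) (Z \- Pr X)).
  rewrite -innerBl; try exact: L2B.
  by congr (complex.Re (inner _ _ _)); apply/funext => w /=; ring.
by rewrite ortho_proj_orth// XZ// subrr.
Qed.

Lemma inner_ortho_proj X Y : L2 P X -> L2 P Y ->
  inner P (X \- Pr X) (Y \- Pr Y) = inner P X (Y \- Pr Y).
Proof.
move=> X2 Y2; have YP2 := L2B Y2 (ortho_proj_L2 Y2).
rewrite innerBl//; last exact: ortho_proj_L2.
by rewrite (ortho_proj_orthr Y2 (ortho_proj_in X2)) subr0.
Qed.

Lemma inner_ortho_projC X Y : L2 P X -> L2 P Y ->
  inner P (X \- Pr X) (Y \- Pr Y) = inner P (X \- Pr X) Y.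
Proof.
move=> X2 Y2; have XP2 := L2B X2 (ortho_proj_L2 X2).
rewrite innerBr//; last exact: ortho_proj_L2.
by rewrite (ortho_proj_orth X2 (ortho_proj_in Y2)) subr0.
Qed.

End L2Generators.

(** Conditional orthogonality of closed spans can be tested on generators: the
    residual of one argument may be dropped, and the inner product with a fixed
    residual is linear and continuous. *)
Lemma cond_orth_closed_span G1 G2 G3 :
  G1 `<=` L2 P -> G2 `<=` L2 P -> G3 `<=` L2 P ->
  let Pr := ortho_proj P (closed_span P G3) in
  (forall X Y, G1 X -> G2 Y -> inner P (X \- Pr X) (Y \- Pr Y) = 0) ->
  cond_orth P (closed_span P G1) (closed_span P G2) (closed_span P G3).
Proof.
move=> G1L G2L G3L Pr H X Y LX LY.
have [X2 Y2] := (closed_span_L2 LX, closed_span_L2 LY).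
rewrite inner_ortho_proj//.
have res2 Z : L2 P Z -> L2 P (Z \- Pr Z).
  by move=> Z2; apply: L2B => //; exact: ortho_proj_L2.
apply: (closed_span_orth G1L) LX; first exact: res2.
move=> g Gg; have g2 := G1L _ Gg.
rewrite -inner_ortho_proj// inner_ortho_projC//.
rewrite (innerC Y2 (res2 _ g2)) (closed_span_orth G2L (res2 _ g2) _ LY)
  ?conjc0//.
move=> g' Gg'; have g'2 := G2L _ Gg'.
by rewrite (innerC (res2 _ g2) g'2) -inner_ortho_projC// H// conjc0.
Qed.

(** On a smaller subspace the projection comes closer to the points of that
    subspace, by Pythagoras. *)
Lemma nrm2_ortho_proj_le G1 G2 X W : G2 `<=` L2 P -> G1 `<=` G2 -> L2 P X ->
  closed_span P G1 W ->
  nrm2 P (ortho_proj P (closed_span P G1) X \- W) <=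
  nrm2 P (ortho_proj P (closed_span P G2) X \- W).
Proof.
move=> G2L G12 X2 LW; have G1L := subset_trans G12 G2L.
have W2 := closed_span_L2 LW.
set P1 := ortho_proj _ _ X; set P2 := ortho_proj _ _ X.
have [P1L P2L] : L2 P P1 /\ L2 P P2 by split; exact: ortho_proj_L2.
have L1 : closed_span P G1 (P1 \- W).
  by apply: closed_spanB => //; exact: ortho_proj_in.
rewrite (_ : P2 \- W = (P1 \- W) \+ (P2 \- P1)); last first.
  by apply/funext => w /=; ring.
rewrite (nrm2D (L2B P1L W2) (L2B P2L P1L)).
suff -> : inner P (P1 \- W) (P2 \- P1) = 0.
  by rewrite mulr0 addr0 lerDl nrm2_ge0.
rewrite (_ : P2 \- P1 = (X \- P1) \- (X \- P2)); last first.
  by apply/funext => w /=; ring.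
rewrite innerBr; try exact: L2B.
rewrite (ortho_proj_orthr G1L X2 L1).
by rewrite (ortho_proj_orthr G2L X2 (closed_spanS G12 L1)) subrr.
Qed.

End Span.

(** * The matrix inequality behind the spectral density condition *)

Section SchurComplement.
Context (C : numClosedFieldType).
Local Open Scope sesquilinear_scope.
Implicit Types (n m k : nat).

Lemma trmxC_mul n m k (A : 'M[C]_(n, m)) (B : 'M[C]_(m, k)) :
  (A *m B)^t* = B^t* *m A^t*.
Proof. by rewrite trmx_mul map_mxM. Qed.

Lemma trmxC_add n m (A B : 'M[C]_(n, m)) : (A + B)^t* = A^t* + B^t*.
Proof. by rewrite linearD/= map_mxD. Qed.

Lemma trmxC_scale n m c (A : 'M[C]_(n, m)) : (c *: A)^t* = c^* *: A^t*.
Proof. by rewrite linearZ/= map_mxZ. Qed.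

Lemma trmxC_delta n (i : 'I_n) : (delta_mx 0 i : 'rV[C]_n)^t* = delta_mx i 0.
Proof.
apply/matrixP => a b; rewrite !mxE.
by rewrite rmorph_nat andbC.
Qed.

Lemma addmxE n m (A B : 'M[C]_(n, m)) i j : (A + B) i j = A i j + B i j.
Proof. by rewrite mxE. Qed.

Lemma oppmxE n m (A : 'M[C]_(n, m)) i j : (- A) i j = - A i j.
Proof. by rewrite mxE. Qed.

Lemma scalemxE n m c (A : 'M[C]_(n, m)) i j : (c *: A) i j = c * A i j.
Proof. by rewrite mxE. Qed.

Lemma mx11_trmxC (A : 'M[C]_1) : (A^t*) 0 0 = (A 0 0)^*%R.
Proof. by rewrite !mxE. Qed.

Lemma entry_form n (M : 'M[C]_n) (i j : 'I_n) :
  ((delta_mx 0 i : 'rV_n) *m M *m (delta_mx 0 j : 'rV_n)^t*) 0 0 = M i j.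
Proof. by rewrite trmxC_delta -(rowE i M) -(colE j) !mxE. Qed.

(** Polarization: with [x + y] the mixed terms cancel, with [x + 'i *: y] they
    agree. *)
Lemma form0_mx0 n (M : 'M[C]_n) :
  (forall x : 'rV_n, (x *m M *m x^t*) 0 0 = 0) -> M = 0.
Proof.
move=> M0.
have polar (x y : 'rV_n) : (x *m M *m y^t*) 0 0 + (y *m M *m x^t*) 0 0 = 0.
  have := M0 (x + y); rewrite trmxC_add !mulmxDl !mulmxDr !addmxE !M0 add0r
    addr0.
  by [].
apply/matrixP => i j; rewrite -(entry_form M) [RHS]mxE.
set x := delta_mx 0 i; set y := delta_mx 0 j.
have := polar x ('i *: y); rewrite trmxC_scale -scalemxAr -!scalemxAl !scalemxE
  conjCi.
rewrite mulNr addrC -mulrBr => /eqP; rewrite mulf_eq0 (negbTE (@neq0Ci _))/=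
  subr_eq0 => /eqP xy.
have := polar x y; rewrite xy.
by rewrite -mulr2n => /eqP; rewrite mulrn_eq0/= => /eqP.
Qed.

(** Positivity of the form includes its being real, which over the complex
    numbers forces the matrix to be Hermitian. *)
Lemma possemidefmx_herm n (M : 'M[C]_n) : possemidefmx M -> M^t* = M.
Proof.
move=> M0; apply/eqP; rewrite -subr_eq0; apply/eqP/form0_mx0 => x.
rewrite mulmxBr mulmxBl addmxE oppmxE; apply/eqP; rewrite subr_eq0; apply/eqP.
have -> : x *m M^t* *m x^t* = (x *m M *m x^t*)^t*.
  by rewrite !trmxC_mul trmxCK mulmxA.
by rewrite mx11_trmxC; apply/CrealP/ger0_real/M0.
Qed.

Lemma posdefmx_semi n (M : 'M[C]_n) : posdefmx M -> possemidefmx M.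
Proof.
move=> M0 x; have [->|/M0/ltW//] := eqVneq x 0.
by rewrite !mul0mx mxE.
Qed.

Lemma posdefmx_unit n (M : 'M[C]_n) : posdefmx M -> M \in unitmx.
Proof.
move=> M0; rewrite -row_free_unit -kermx_eq0; apply: contraT => /rowV0Pn[x].
by move=> /sub_kermxP xM /M0; rewrite xM mul0mx mxE ltxx.
Qed.

Lemma form_diag n (d x : 'rV[C]_n) :
  (x *m diag_mx d *m x^t*) 0 0 = \sum_i d 0 i * `|x 0 i| ^+ 2.
Proof.
rewrite mxE; apply: eq_bigr => i _; rewrite mul_mx_diag !mxE normCK.
by rewrite mulrAC mulrC.
Qed.

(** The square root is defined by choice; the spectral theorem shows that there
    is one. *)
Lemma sqrtmxP n (M : 'M[C]_n) : possemidefmx M ->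
  possemidefmx (sqrtmx M) /\ sqrtmx M *m sqrtmx M = M.
Proof.
move=> M0.
apply: (@xgetPex _ 0 [set S | possemidefmx S /\ S *m S = M]).
have /hermitian_normalmx/orthomx_spectralP : M \is hermsymmx.
  by apply/is_hermitianmxP; rewrite expr0 scale1r possemidefmx_herm.
set U := spectralmx M; set dg := spectral_diag M => ME.
have Uu : U \is unitarymx := spectral_unitarymx M.
have UU : U *m U^t* = 1%:M by apply/unitarymxP.
rewrite invmx_unitary// in ME.
have d0 i : 0 <= dg 0 i.
  have := M0 (delta_mx 0 i *m U).
  rewrite ME trmxC_mul !mulmxA -(mulmxA _ U) UU mulmx1.
  by rewrite -(mulmxA _ U) UU mulmx1 entry_form mxE eqxx.
pose s := \row_i sqrtC (dg 0 i).
exists (U^t* *m diag_mx s *m U); split.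
  move=> x; have -> : x *m (U^t* *m diag_mx s *m U) *m x^t* =
      (x *m U^t*) *m diag_mx s *m (x *m U^t*)^t*.
    by rewrite trmxC_mul trmxCK !mulmxA.
  rewrite form_diag; apply: sumr_ge0 => i _.
  by rewrite mulr_ge0 ?exprn_ge0// mxE sqrtC_ge0.
rewrite [RHS]ME !mulmxA -(mulmxA _ U) UU mulmx1.
rewrite -(mulmxA _ (diag_mx s) (diag_mx s)) mulmx_diag;
  congr (_ *m diag_mx _ *m _).
by apply/rowP => i; rewrite !mxE -expr2 sqrtCK.
Qed.

(** Completing the square, the form of the Hermitian matrix with the diagonal
    blocks [FA], [FB] and the upper block [FAB] is the sum of the form of its Schur complement
    [FA - FAB FB^-1 FAB^t*] at [x] and a nonnegative term; conjugating the
    hypothesis by the square root of [FA] says that the Schur complement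
    dominates [e *: FA]. *)
Lemma schur_form_ge n m (FA : 'M[C]_n) (FAB : 'M[C]_(n, m)) (FB : 'M[C]_m) e
    (x : 'rV[C]_n) (y : 'rV[C]_m) :
  posdefmx FA -> posdefmx FB ->
  possemidefmx ((1 - e)%:M -
    invsqrtmx FA *m FAB *m invmx FB *m FAB^t* *m invsqrtmx FA) ->
  e * (x *m FA *m x^t*) 0 0 <=
  (x *m FA *m x^t*) 0 0 + (x *m FAB *m y^t*) 0 0 +
  ((y *m FAB^t* *m x^t*) 0 0 + (y *m FB *m y^t*) 0 0).
Proof.
move=> FA0 FB0 cond.
have [S0 SS] := sqrtmxP (posdefmx_semi FA0).
have FBu := posdefmx_unit FB0.
have Sh := possemidefmx_herm S0.
have FBh := possemidefmx_herm (posdefmx_semi FB0).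
have FBih : (invmx FB)^t* = invmx FB.
  rewrite -[LHS]mul1mx -(mulVmx FBu) -mulmxA -[X in X *m _^t*]FBh -trmxC_mul.
  by rewrite mulVmx// trmx1 map_mx1 mulmx1.
have Su : sqrtmx FA \in unitmx.
  by have := posdefmx_unit FA0; rewrite -{1}SS unitmx_mul andbb.
set S := sqrtmx FA in S0 SS Sh Su.
have := cond (x *m S); rewrite /invsqrtmx -/S trmxC_mul Sh.
rewrite mulmxBr mulmxBl mul_mx_scalar !mulmxA.
rewrite -(mulmxA x S (invmx S)) mulmxV// mulmx1.
rewrite -(mulmxA _ (invmx S) S) mulVmx// mulmx1 -!scalemxAl -(mulmxA x S S) SS.
rewrite addmxE oppmxE scalemxE => schur.
have := posdefmx_semi FB0 (y + x *m FAB *m invmx FB).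
rewrite trmxC_add !trmxC_mul FBih !mulmxDl !mulmxDr.
rewrite -(mulmxA _ (invmx FB) FB) mulVmx// mulmx1 !mulmxA.
rewrite -(mulmxA _ FB (invmx FB)) mulmxV// mulmx1 !addmxE => square.
rewrite -subr_ge0; apply: le_trans (addr_ge0 schur square) _.
by rewrite le_eqVlt; apply/orP; left; apply/eqP; ring.
Qed.

End SchurComplement.

Section Blocks.
Context (C : numClosedFieldType) (k : nat).
Local Open Scope sesquilinear_scope.
Implicit Types (M F : 'M[C]_k) (A B : {set 'I_k}).

(** The rows of the identity matrix indexed by [A]: multiplying by it on the
    left and by adjoints on the right extracts blocks. *)
Definition selmx A : 'M[C]_(#|A|, k) := \matrix_(i, j) (enum_val i == j)%:R.

Lemma blockmxE M A B : blockmx M A B = selmx A *m M *m (selmx B)^t*.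
Proof.
apply/matrixP => i j; rewrite !mxE (bigD1 (enum_val j))//= !mxE eqxx conjC1
  mulr1.
rewrite [X in _ + X]big1 ?addr0; last first.
  by move=> l /negbTE lj; rewrite !mxE eq_sym lj conjC0 mulr0.
rewrite (bigD1 (enum_val i))//= !mxE eqxx mul1r big1 ?addr0// => l /negbTE li.
by rewrite !mxE eq_sym li mul0r.
Qed.

Lemma selmxK A : selmx A *m (selmx A)^t* = 1%:M.
Proof.
have := blockmxE 1%:M A A; rewrite mulmx1 => <-.
by apply/matrixP => i j; rewrite !mxE (inj_eq enum_val_inj).
Qed.

Lemma blockmx_posdef F A : posdefmx F -> posdefmx (blockmx F A A).
Proof.
move=> F0 x x0; have -> : x *m blockmx F A A *m x^t* =
    (x *m selmx A) *m F *m (x *m selmx A)^t*.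
  by rewrite blockmxE trmxC_mul !mulmxA.
apply: F0; apply: contraNneq x0 => xA.
by rewrite -[x]mulmx1 -(selmxK A) mulmxA xA mul0mx.
Qed.

Lemma selmx_supp A (x : 'rV[C]_k) : (forall i, i \notin A -> x 0 i = 0) ->
  x *m (selmx A)^t* *m selmx A = x.
Proof.
move=> xA; apply/rowP => j; rewrite mxE.
have [jA|jA] := boolP (j \in A); last first.
  rewrite xA// big1// => l _; rewrite [selmx _ _ _]mxE.
  case: eqP => [lj|]; last by rewrite mulr0.
  by move: jA; rewrite -lj enum_valP.
rewrite (bigD1 (enum_rank_in jA j))//= big1 ?addr0; last first.
  move=> l /negbTE lj; rewrite [selmx _ _ _]mxE.
  case: eqP => [ej|]; last by rewrite mulr0.
  by case/eqP: (negbT lj); apply: enum_val_inj; rewrite ej enum_rankK_in.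
rewrite [selmx _ _ _]mxE enum_rankK_in// eqxx mulr1 mxE (bigD1 j)//= big1
  ?addr0.
  by rewrite !mxE enum_rankK_in// eqxx conjC1 mulr1.
by move=> l /negbTE lj; rewrite !mxE enum_rankK_in// eq_sym lj conjC0 mulr0.
Qed.

(** [schur_form_ge] for the blocks of one matrix [F]. Vectors supported on
    different blocks cannot cancel each other beyond the factor [e]. *)
Lemma block_form_ge F A B e (x y : 'rV[C]_k) : posdefmx F ->
  possemidefmx ((1 - e)%:M - invsqrtmx (blockmx F A A) *m blockmx F A B *m
    invmx (blockmx F B B) *m blockmx F B A *m invsqrtmx (blockmx F A A)) ->
  (forall i, i \notin A -> x 0 i = 0) -> (forall i, i \notin B -> y 0 i = 0) ->
  e * (x *m F *m x^t*) 0 0 <= ((x + y) *m F *m (x + y)^t*) 0 0.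
Proof.
move=> F0 cond xA yB.
have Fh := possemidefmx_herm (posdefmx_semi F0).
have BA : blockmx F B A = (blockmx F A B)^t*.
  by rewrite !blockmxE !trmxC_mul trmxCK Fh mulmxA.
have := @schur_form_ge C _ _ _ (blockmx F A B) _ e (x *m (selmx A)^t*) (y *m
  (selmx B)^t*)
  (blockmx_posdef F0) (blockmx_posdef F0).
rewrite -BA => /(_ cond).
have blk A' B' (u v : 'rV[C]_k) : (forall i, i \notin A' -> u 0 i = 0) ->
    (forall i, i \notin B' -> v 0 i = 0) ->
    u *m (selmx A')^t* *m blockmx F A' B' *m (v *m (selmx B')^t*)^t* =
    u *m F *m v^t*.
  move=> uA vB; rewrite -{2}(selmx_supp uA) -{2}(selmx_supp vB) blockmxE.
  by rewrite !trmxC_mul !trmxCK !mulmxA.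
rewrite !blk//; move/le_trans; apply.
by rewrite trmxC_add !mulmxDl !mulmxDr !addmxE.
Qed.

End Blocks.

(** * The spectral isometry and intersections of spans *)

Section SpectralForm.
Context (R : realType) (d : measure_display) (T : measurableType d).
Variables (P : probability T R) (k : nat) (Y : 'I_k -> R -> T -> R[i]).
Hypothesis Y2 : forall v t, L2 P (Y v t).
Implicit Types (A B S : {set 'I_k}) (I J : interval R).
Implicit Types (s : seq (R[i] * 'I_k * R)).
Local Open Scope sesquilinear_scope.

Definition observables A I : set (T -> R[i]) :=
  [set X | exists a u, [/\ a \in A, u \in I & X = Y a u]].

Lemma observables_L2 A I : observables A I `<=` L2 P.
Proof. by move=> _ [a [u [_ _ ->]]]. Qed.

Lemma observablesS A B I : A \subset B -> observables A I `<=` observables B I.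
Proof.
by move=> /fintype.subsetP AB _ [a [u [aA uI ->]]]; exists a, u; split => //;
  exact: AB.
Qed.

Definition combination s : T -> R[i] :=
  fun w => \sum_(p <- s) p.1.1 * Y p.1.2 p.2 w.

Definition cis (x : R) : R[i] := cos x +i* sin x.

(** The coefficient vector at frequency [l] of the spectral representation of
    [combination s]. *)
Definition transfer s (l : R) : 'rV[R[i]]_k :=
  \sum_(p <- s) (p.1.1 * cis (l * p.2)) *: delta_mx 0 p.1.2.

Lemma combination_cat s s' :
  combination (s ++ s') = combination s \+ combination s'.
Proof. by apply/funext => w /=; rewrite /combination big_cat. Qed.

Lemma transfer_cat s s' l : transfer (s ++ s') l = transfer s l + transfer s' l.
Proof. by rewrite /transfer big_cat. Qed.

Lemma combination_cons c a u s :
  combination ((c, a, u) :: s) = (c \*o Y a u) \+ combination s.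
Proof. by apply/funext => w /=; rewrite /combination big_cons. Qed.

Lemma transfer_cons c a u s l : transfer ((c, a, u) :: s) l =
  (c * cis (l * u)) *: delta_mx 0 a + transfer s l.
Proof. by rewrite /transfer big_cons. Qed.

Lemma combination_nil : combination [::] = fun=> 0.
Proof. by apply/funext => w; rewrite /combination big_nil. Qed.

Lemma transfer_nil l : transfer [::] l = 0.
Proof. by rewrite /transfer big_nil. Qed.

Lemma combination_L2 s : L2 P (combination s).
Proof.
elim: s => [|[[c a] u] s IH]; first by rewrite combination_nil; exact: L2_0.
by rewrite combination_cons; apply: L2D => //; exact: L2Z.
Qed.

Lemma lin_span_observables A I X : lin_span (observables A I) X ->
  exists s, all (fun p => (p.1.2 \in A) && (p.2 \in I)) s /\ X = combination s.
Proof.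
move: X; apply: lin_span_ind.
- by exists [::]; rewrite combination_nil.
- move=> _ _ [s [sA ->]] [s' [s'A ->]]; exists (s ++ s').
  by rewrite all_cat sA s'A combination_cat.
- move=> c _ [s [sA ->]]; exists [seq (c * p.1.1, p.1.2, p.2) | p <- s]; split.
    by rewrite all_map.
  apply/funext => w /=; rewrite /combination big_map mulr_sumr.
  by apply: eq_bigr => p _; rewrite mulrA.
- move=> _ [a [u [aA uI ->]]]; exists [:: (1, a, u)]; rewrite /= aA uI;
  split => //.
  by apply/funext => w; rewrite /combination big_seq1 mul1r.
Qed.

Lemma transfer_supp A I s l i :
  all (fun p => (p.1.2 \in A) && (p.2 \in I)) s -> i \notin A ->
  transfer s l 0 i = 0.
Proof.
move=> /allP sA iA; rewrite /transfer summxE big_seq big1// => p /sA/andP[pA _].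
rewrite !mxE eqxx/=; case: eqP => [ip|]; last by rewrite mulr0.
by move: iA; rewrite ip pA.
Qed.

Section Density.
Variable f : R -> 'M[R[i]]_k.
Hypothesis fY : spectral_density P Y f.

Let leb := @lebesgue_measure R.

Definition spectral_form s s' (l : R) : R[i] :=
  (transfer s l *m f l *m (transfer s' l)^t*) 0 0.

Lemma cisBM l u v : cis (l * (u - v)) = cis (l * u) * Num.conj (cis (l * v)).
Proof.
rewrite /cis mulrBr cosB sinB; apply/eqP; rewrite eq_complex /=.
by apply/andP; split; apply/eqP; ring.
Qed.

Let kernel a u b v (l : R) : R[i] := cis (l * (u - v)) * f l a b.

Let kernel_int a u b v : cintegrable leb (kernel a u b v).
Proof.
have mlin : measurable_fun setT (fun l : R => l * (u - v)) by exact: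
  measurable_funM.
apply: cintegrableM_bounded; last by have [+ _] := fY; exact.
- split; apply: measurableT_comp mlin; apply: continuous_measurable_fun.
    exact: continuous_cos.
  exact: continuous_sin.
- by move=> l; rewrite ler_norml cos_geN1 cos_le1.
- by move=> l; rewrite ler_norml sin_geN1 sin_le1.
Qed.

Let kernel_inner a u b v :
  inner P (Y a u) (Y b v) = cintegral leb (kernel a u b v).
Proof. by have [_ /(_ a b v (u - v))] := fY; rewrite addrC subrK. Qed.

Let single (b : 'I_k) (v l : R) : 'rV[R[i]]_k := cis (l * v) *: delta_mx 0 b.

Let half_isometry s b v :
  let F l := (transfer s l *m f l *m (single b v l)^t*) 0 0 in
  cintegrable leb F /\ inner P (combination s) (Y b v) = cintegral leb F.
Proof.
elim: s => [|[[c a] u] s /= [Fi FE]] /=.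
  rewrite combination_nil inner0l.
  rewrite (_ : (fun l => _) = (fun=> 0)); last first.
    by apply/funext => l; rewrite transfer_nil !mul0mx mxE.
  by rewrite cintegral0; split => //; split; apply: integrable0.
rewrite (_ : (fun l => _) = (c \*o kernel a u b v) \+
    (fun l => (transfer s l *m f l *m (single b v l)^t*) 0 0)); last first.
  apply/funext => l; rewrite transfer_cons !mulmxDl addmxE /=; congr (_ + _).
  rewrite /single trmxC_scale -!scalemxAl -scalemxAr !scalemxE entry_form.
  by rewrite /kernel cisBM; ring.
split; first by apply: cintegrableD => //; exact: cintegrableZ.
rewrite cintegralD//; last exact: cintegrableZ.
rewrite cintegralZ// -FE -kernel_inner combination_cons innerDl ?innerZl//.
  exact: L2Z.
exact: combination_L2.
Qed.

(** [combination s] and [transfer s] correspond under Kolmogorov's isometry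
    between the span of the process and the vector functions with the
    Hermitian form of the spectral density. *)
Lemma spectral_isometry s s' : cintegrable leb (spectral_form s s') /\
  inner P (combination s) (combination s') = cintegral leb (spectral_form s s').
Proof.
elim: s' => [|[[c b] v] s' [Fi FE]].
  rewrite /spectral_form combination_nil innerC ?inner0l ?conjc0; last 2 first.
  - exact: L2_0.
  - exact: combination_L2.
  rewrite (_ : (fun l => _) = (fun=> 0)); last first.
    by apply/funext => l; rewrite transfer_nil trmx0 map_mx0 mulmx0 mxE.
  by rewrite cintegral0; split => //; split; apply: integrable0.
have [Gi GE] := half_isometry s b v.
rewrite (_ : spectral_form _ _ = (c^*%C \*o
    (fun l => (transfer s l *m f l *m (single b v l)^t*) 0 0)) \+
    spectral_form s s'); last first.
  apply/funext => l; rewrite /spectral_form transfer_cons trmxC_add.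
  rewrite mulmxDr addmxE /=; congr (_ + _).
  by rewrite -scalerA trmxC_scale -scalemxAr scalemxE.
split; first by apply: cintegrableD => //; exact: cintegrableZ.
rewrite cintegralD//; last exact: cintegrableZ.
rewrite cintegralZ// -FE -GE combination_cons.
have [s2 s'2] := (combination_L2 s, combination_L2 s').
by rewrite innerDr ?innerZr//; exact: L2Z.
Qed.

End Density.

(** Integrate [block_form_ge] over the frequencies: the spans of disjoint
    subprocesses form a positive angle. *)
Lemma disjoint_span_angle : spectral_density_condition P Y ->
  exists2 e : R, 0 < e & forall A B I J X Z, [disjoint A & B]%B ->
    lin_span (observables A I) X -> lin_span (observables B J) Z ->
    e * nrm2 P X <= nrm2 P (X \+ Z).
Proof.
move=> [f [fY f0 [e [e0 e1 cond]]]]; exists e => // A B I J X Z AB.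
move=> /lin_span_observables[s [sA ->{X}]] /lin_span_observables[s' [s'B
  ->{Z}]].
rewrite -combination_cat -subr_ge0 /nrm2.
have [i1 E1] := spectral_isometry fY s s.
have [i2 E2] := spectral_isometry fY (s ++ s') (s ++ s').
rewrite E1 E2.
have -> : complex.Re (cintegral lebesgue_measure (spectral_form f (s ++ s') (s
  ++ s'))) -
    e * complex.Re (cintegral lebesgue_measure (spectral_form f s s)) =
    complex.Re (cintegral (@lebesgue_measure R) (spectral_form f (s ++ s') (s
      ++ s') \+
      ((- e)%:C \*o spectral_form f s s))).
  rewrite cintegralD//; last exact: cintegrableZ.
  by rewrite cintegralZ// cReD cReM /= mul0r subr0 mulNr.
apply: ae_cintegral_ge0.
  by apply: cintegrableD => //; exact: cintegrableZ.
apply: ae_imply cond => l /(_ A B AB) condl.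
have := @block_form_ge _ _ (f l) A B e%:C (transfer s l) (transfer s' l) (f0 l).
rewrite -(rmorph1 (real_complex R)) -rmorphB => /(_ condl).
rewrite lecE => H.
have {H} : complex.Re (e%:C * spectral_form f s s l) <=
    complex.Re (spectral_form f (s ++ s') (s ++ s') l).
  rewrite /spectral_form transfer_cat.
  by have /andP[] := H (fun i => transfer_supp l sA) (fun i => transfer_supp l
    s'B).
by rewrite /= cReD !cReM /= !mul0r !subr0 mulNr subr_ge0.
Qed.

(** Write [W], up to a small error, as [U + V] with [U] over [S1 :&: S2] and
    [V] over [S1 :\: S2], and as [X'] over [S2]. Then [V + (U - X')] is small,
    and by [disjoint_span_angle] so is [V] alone; hence [W] is close to [U]. *)
Lemma Lspan_setI I S1 S2 W : spectral_density_condition P Y ->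
  Lspan P Y S1 I W -> Lspan P Y S2 I W -> Lspan P Y (S1 :&: S2) I W.
Proof.
move=> /disjoint_span_angle[e e0 angle].
move=> /(closed_spanP (@observables_L2 _ _)) [W2 W1] /(closed_spanP
  (@observables_L2 _ _)) [_ W2'].
apply/(closed_spanP (@observables_L2 _ _)); split => // z z0.
have e8 : 0 < 2 + 8 / e by rewrite addr_gt0 ?divr_gt0.
(* |W - U|^2 <= 2 |W - X|^2 + 2 |V|^2 < 2 dl + 2 (4 dl / e). *)
set dl := z / (2 + 8 / e); have dl0 : 0 < dl by rewrite divr_gt0.
have dlE : dl * 2 + dl * (8 / e) = z by rewrite -mulrDr divfK// gt_eqF.
have [X [X1 WX]] := W1 _ dl0; have [X' [X'2 WX']] := W2' _ dl0.
have [U [V [GU GV XE]]] : exists U V, [/\ lin_span (observables (S1 :&: S2) I)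
  U,
    lin_span (observables (S1 :\: S2) I) V & X = U \+ V].
  clear WX; move: X X1; apply: lin_span_ind.
  - exists (fun=> 0), (fun=> 0); split; [exact: lin_span0..|].
    by apply/funext => w /=; rewrite addr0.
  - move=> _ _ [U [V [GU GV ->]]] [U' [V' [GU' GV' ->]]].
    exists (U \+ U'), (V \+ V'); split; [exact: lin_spanD..|].
    by apply/funext => w /=; rewrite addrACA.
  - move=> c _ [U [V [GU GV ->]]]; exists (c \*o U), (c \*o V).
    split; [exact: lin_spanZ..|].
    by apply/funext => w /=; rewrite mulrDr.
  - move=> _ [a [u [aS uI ->]]]; have [aS2|aS2] := boolP (a \in S2).
      exists (Y a u), (fun=> 0); split; [|exact: lin_span0|].
        by apply: lin_span_mem; exists a, u; rewrite inE aS aS2.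
      by apply/funext => w /=; rewrite addr0.
    exists (fun=> 0), (Y a u); split; [exact: lin_span0| |].
      by apply: lin_span_mem; exists a, u; rewrite inE aS aS2.
    by apply/funext => w /=; rewrite add0r.
have obs2 A Z : lin_span (observables A I) Z -> L2 P Z.
  by apply: lin_span_L2; exact: observables_L2.
have [X2 U2 V2 X'L] : [/\ L2 P X, L2 P U, L2 P V & L2 P X'].
  by split; [exact: obs2 X1|exact: obs2 GU|exact: obs2 GV|exact: obs2 X'2].
exists U; split => //.
have dis : [disjoint S1 :\: S2 & S2]%B.
  by rewrite -setI_eq0; apply/eqP/setP => i; rewrite !inE; case: (i \in S2);
    rewrite ?andbF.
have GUX : lin_span (observables S2 I) (U \- X').
  rewrite subfunE; apply: lin_spanD; last exact: lin_spanZ.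
  by apply: lin_spanS GU; apply: observablesS; exact: subsetIr.
have VX := angle _ _ _ _ _ _ dis GV GUX.
rewrite (_ : V \+ (U \- X') = X \- X') in VX; last first.
  by rewrite XE; apply/funext => w /=; ring.
have tri := nrm2B_triangle X2 W2 X'L.
rewrite (nrm2BC _ X W) in tri.
have WU := nrm2D_le (L2B W2 X2) V2.
rewrite (_ : (W \- X) \+ V = W \- U) in WU; last first.
  by rewrite XE; apply/funext => w /=; ring.
have Vle : nrm2 P V <= dl * (4 / e).
  by rewrite mulrA ler_pdivlMr// mulrC; lra.
by lra.
Qed.

Lemma Lspan_setD I B W : spectral_density_condition P Y ->
  Lspan P Y [set: 'I_k]%SET I W ->
  (forall b, b \in B -> Lspan P Y ([set: 'I_k] :\ b)%SET I W) ->
  Lspan P Y ([set: 'I_k] :\: B)%SET I W.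
Proof.
move=> cond WV WB.
have -> : ([set: 'I_k] :\: B)%SET = ([set: 'I_k] :\: [set x in enum B])%SET.
  by congr (_ :\: _)%SET; apply/setP => x; rewrite inE mem_enum.
have : {subset enum B <= B} by move=> x; rewrite mem_enum.
elim: (enum B) => [_|b bs IH bsB].
  by rewrite (_ : (_ :\: _)%SET = [set: 'I_k]%SET)//; apply/setP => x;
    rewrite !inE.
rewrite (_ : (_ :\: _)%SET =
    ([set: 'I_k] :\: [set x in bs]) :&: ([set: 'I_k] :\ b))%SET; last first.
  by apply/setP => x; rewrite !inE !andbT negb_or andbC.
apply: Lspan_setI => //; last by apply: WB; apply: bsB; rewrite inE eqxx.
by apply: IH => x xbs; apply: bsB; rewrite inE xbs orbT.
Qed.

End SpectralForm.

(** * The block-recursive Markov properties *)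

Section MeanSquareLimits.
Context (R : realType) (d : measure_display) (T : measurableType d).
Variable P : probability T R.
Implicit Types (X Y Z W : T -> R[i]).

Lemma ms_lim_near (I : Type) (F : set_system I) {FF : Filter F}
    (X : I -> T -> R[i]) W (e : R) : (forall i, L2 P (X i)) ->
  ms_lim P F X W -> 0 < e -> \forall i \near F, nrm2 P (X i \- W) < e.
Proof.
move=> X2 [W2 XW] e0.
have : \forall i \near F, (second_moment P (X i \- W)%R < e%:E)%E.
  by apply: (XW [set x | (x < e%:E)%E]); apply: open_nbhs_nbhs; split;
    [exact: open_ereal_lt_ereal|rewrite /= lte_fin].
by apply: filterS => i; rewrite second_momentE ?lte_fin//; exact: L2B.
Qed.

Lemma ms_lim_unique (I : Type) (F : set_system I) {FF : ProperFilter F}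
    (X : I -> T -> R[i]) W W' : (forall i, L2 P (X i)) ->
  ms_lim P F X W -> ms_lim P F X W' -> nrm2 P (W \- W') = 0.
Proof.
move=> X2 XW XW'; apply/eqP; rewrite eq_le nrm2_ge0 andbT.
apply/ler_addgt0Pl => e e0; rewrite addr0.
have e4 : 0 < e / 4 by rewrite divr_gt0.
have [i [Xi X'i]] :=
  filter_ex (filterI (ms_lim_near X2 XW e4) (ms_lim_near X2 XW' e4)).
have [[W2 _] [W'2 _]] := (XW, XW').
apply: le_trans (nrm2B_triangle W2 (X2 i) W'2) _.
by rewrite (nrm2BC P W) /=; move: Xi X'i => /=; lra.
Qed.

Lemma closed_span_ms_lim (G : set (T -> R[i])) (I : Type) (F : set_system I)
    {FF : ProperFilter F} (X : I -> T -> R[i]) W : G `<=` L2 P ->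
  (forall i, closed_span P G (X i)) -> ms_lim P F X W -> closed_span P G W.
Proof.
move=> G2 GX XW; have X2 i : L2 P (X i) := closed_span_L2 (GX i).
apply: (closed_span_lim G2); first by have [] := XW.
move=> e e0; have [i Xi] := filter_ex (ms_lim_near X2 XW e0).
by exists (X i); rewrite nrm2BC.
Qed.

Lemma ms_derivn_L2 n (X : R -> T -> R[i]) t : (forall u, L2 P (X u)) ->
  L2 P (ms_derivn P n X t).
Proof.
move=> X2; case: n => [|n] /=; first exact: X2.
by rewrite /ms_deriv; case: xgetP => [W _ []|_] //; exact: L2_0.
Qed.

End MeanSquareLimits.

Section MarkovProperty.
Context (R : realType) (d : measure_display) (T : measurableType d).
Variables (P : probability T R) (k : nat) (Y : 'I_k -> R -> T -> R[i]).
Hypothesis Y2 : forall v t, L2 P (Y v t).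
Hypothesis Yspec : spectral_density_condition P Y.
Implicit Types (A B S : {set 'I_k}) (a b v : 'I_k) (t : R) (I : interval R).

Let V := [set: 'I_k]%SET.

Lemma set1_neq0 v : ([set v] = finset.set0)%SET -> False.
Proof. by move=> /setP/(_ v); rewrite !inE eqxx. Qed.

Lemma Lspan_L2 A I : Lspan P Y A I `<=` L2 P.
Proof. exact: closed_span_L2. Qed.

Lemma LspanS A B I : A \subset B -> Lspan P Y A I `<=` Lspan P Y B I.
Proof. by move=> AB; apply: closed_spanS; exact: observablesS. Qed.

Lemma Lspan_gen A I a u : a \in A -> u \in I -> Lspan P Y A I (Y a u).
Proof.
move=> aA uI; apply: (closed_span_mem (observables_L2 Y2 (A := A) (I := I))).
by exists a, u.
Qed.

Let obs2 A I := observables_L2 Y2 (A := A) (I := I).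

Lemma proj_past_in S t X : L2 P X ->
  Lpast P Y S t (ortho_proj P (Lpast P Y S t) X).
Proof. exact: (ortho_proj_in (@obs2 _ _)). Qed.

(** If [X] is uncorrelated with the past of [b] given the past of the other
    components, its projection on the full past does not involve [b]. *)
Lemma proj_past_avoids b t X : L2 P X ->
  (forall Z, Lpast P Y [set b]%SET t Z ->
     inner P (X \- ortho_proj P (Lpast P Y (V :\ b)%SET t) X)
             (Z \- ortho_proj P (Lpast P Y (V :\ b)%SET t) Z) = 0) ->
  Lpast P Y (V :\ b)%SET t (ortho_proj P (Lpast P Y V t) X).
Proof.
move=> X2 Xb; set Pb := ortho_proj P (Lpast P Y (V :\ b)%SET t) in Xb *.
have Pin : Lpast P Y (V :\ b)%SET t (Pb X) by exact: proj_past_in.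
have XP2 : L2 P (X \- Pb X) by apply: L2B => //; exact: Lspan_L2 Pin.
have orth W : Lpast P Y V t W -> inner P (X \- Pb X) W = 0.
  move=> LW; rewrite innerC//; last exact: Lspan_L2 LW.
  rewrite (closed_span_orth (@obs2 V _) XP2 _ LW) ?conjc0// => _ [c [u [_ ut
    ->]]].
  rewrite innerC// (_ : inner _ _ _ = 0) ?conjc0//.
  have [cb|cb] := eqVneq c b; last first.
    by apply: (ortho_proj_orth (@obs2 _ _)) => //; apply: Lspan_gen => //;
      rewrite !inE cb.
  rewrite -(inner_ortho_projC (@obs2 _ _))//; apply: Xb.
  by rewrite cb; apply: Lspan_gen => //; rewrite inE.
have PV : Lpast P Y V t (Pb X) by apply: LspanS Pin; exact: finset.subsetT.
have P0 := ortho_proj_unique (@obs2 V _) X2 PV orth.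
apply: (closed_span_nrm2 (@obs2 (V :\ b)%SET _) Pin).
  by exact/Lspan_L2/proj_past_in.
by rewrite nrm2BC.
Qed.

(** The residual with respect to a smaller past that already contains the
    projection on the full past is orthogonal to the full past. *)
Lemma proj_past_orth S t X Z : L2 P X ->
  Lpast P Y S t (ortho_proj P (Lpast P Y V t) X) -> Lpast P Y V t Z ->
  inner P (X \- ortho_proj P (Lpast P Y S t) X) Z = 0.
Proof.
move=> X2 LU LZ; have Z2 := Lspan_L2 LZ.
set U := ortho_proj P (Lpast P Y V t) X in LU *.
set U' := ortho_proj P (Lpast P Y S t) X.
have U2 : L2 P U := Lspan_L2 LU.
have U'2 : L2 P U' by exact/Lspan_L2/proj_past_in.
have U0 : nrm2 P (U \- U') = 0.
  apply: (ortho_proj_unique (@obs2 _ _)) => // W LW.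
  by apply: (ortho_proj_orth (@obs2 _ _)) => //; apply: LspanS LW;
    exact: finset.subsetT.
rewrite (_ : X \- U' = (X \- U) \+ (U \- U')); last first.
  by apply/funext => w /=; ring.
rewrite innerDl//; try exact: L2B.
by rewrite (ortho_proj_orth (@obs2 _ _))// nrm2_inner0 ?addr0//; exact: L2B.
Qed.

(** By [proj_past_avoids] for each [b] of [B] and [Lspan_setD], the projection
    of a generator on the full past avoids [B]; then [proj_past_orth] applies. *)
Lemma not_causes_block A B :
  (forall a b, a \in A -> b \in B -> not_causes P Y [set b]%SET [set a]%SET V)
    ->
  not_causes P Y B A V.
Proof.
move=> pair; right; right => t.
apply: cond_orth_closed_span; [exact: obs2..|].
move=> _ _ [a [u [aA ut ->]]] [b [v [bB vt ->]]].
rewrite (inner_ortho_projC (@obs2 _ _))//.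
apply: proj_past_orth => //; last by apply: Lspan_gen => //; rewrite inE.
apply: Lspan_setD => //; first exact: proj_past_in.
move=> b' b'B; apply: proj_past_avoids => // Z LZ.
have [/set1_neq0//|[/set1_neq0//|/(_ t)]] := pair a b' aA b'B; apply => //.
by apply: Lspan_gen => //; rewrite inE.
Qed.

Lemma not_contemp_block A B :
  (forall a b, a \in A -> b \in B -> not_contemp P Y [set b]%SET [set a]%SET V)
    ->
  not_contemp P Y B A V.
Proof.
move=> pair; right; right => t.
apply: cond_orth_closed_span; [exact: obs2..|].
move=> _ _ [b [v [bB vt ->]]] [a [u [aA ut ->]]].
have [/set1_neq0//|[/set1_neq0//|/(_ t)]] := pair a b aA bB; apply.
  by apply: Lspan_gen => //; rewrite inE.
by apply: Lspan_gen => //; rewrite inE.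
Qed.

Variable j : 'I_k -> nat.

Lemma quotient_L2 b t h : L2 P (ms_quotient (DY P Y j b) t h).
Proof.
rewrite (_ : ms_quotient _ _ _ =
  (h^-1)%:C \*o (DY P Y j b (t + h) \- DY P Y j b t))//.
by apply/L2Z/L2B; exact: ms_derivn_L2.
Qed.

(** The limit [W] of the projected quotients lies in every past that omits one
    component of [B], by closedness, hence in the past that omits all of [B]. *)
Lemma not_causes0_block A B :
  (forall a b, a \in A -> b \in B ->
     not_causes0 P Y j [set b]%SET [set a]%SET V) ->
  not_causes0 P Y j B A V.
Proof.
move=> pair; have [->|[b0 b0B]] := set_0Vmem B; first by left.
right; right => t a aA; set Q := ms_quotient _ t.
have Q2 h : L2 P (Q h) := quotient_L2 a t h.
have proj2 S h : L2 P (ortho_proj P (Lpast P Y S t) (Q h)).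
  exact/Lspan_L2/proj_past_in.
have lims b : b \in B -> exists W W',
    [/\ ms_lim P (0 : R)^'+ (fun h => ortho_proj P (Lpast P Y V t) (Q h)) W,
        ms_lim P (0 : R)^'+
          (fun h => ortho_proj P (Lpast P Y (V :\ b)%SET t) (Q h)) W'
      & as_eq P W W'].
  move=> bB; have [/set1_neq0//|[/set1_neq0//|]] := pair a b aA bB.
  by move=> /(_ t a); rewrite inE eqxx => /(_ isT).
have [W [_ [QW _ _]]] := lims _ b0B; have W2 : L2 P W by have [] := QW.
have LW : Lpast P Y V t W.
  by apply: (closed_span_ms_lim (@obs2 _ _)) QW => // h; exact: proj_past_in.
have LWB : Lpast P Y (V :\: B)%SET t W.
  apply: Lspan_setD => // b /lims[Wb [Wb' [QWb QWb' Wbb']]].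
  have [[Wb2 _] [Wb'2 _]] := (QWb, QWb').
  have LWb' : Lpast P Y (V :\ b)%SET t Wb'.
    by apply: (closed_span_ms_lim (@obs2 _ _)) QWb' => // h;
      exact: proj_past_in.
  have LWb := closed_span_nrm2 (@obs2 _ _) LWb' Wb2 (as_eq_nrm2 Wb2 Wb'2 Wbb').
  by apply: (closed_span_nrm2 (@obs2 _ _) LWb) => //;
    exact: ms_lim_unique QW QWb.
(* Since W lies in the smaller past, the projections on that past converge to
   the same representative. *)
exists W, W; split => //; last exact: aeW.
split => //; have [_ QW0] := QW.
apply: squeeze_cvge (cvg_cst 0%E) QW0.
apply: nearW => h; rewrite second_moment_ge0/= !second_momentE ?lee_fin;
  try exact: L2B.
by apply: (nrm2_ortho_proj_le (@obs2 _ _)) => //; apply: observablesS;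
  exact: finset.subsetT.
Qed.

Lemma not_contemp0_block A B :
  (forall a b, a \in A -> b \in B ->
     not_contemp0 P Y j [set b]%SET [set a]%SET V) ->
  not_contemp0 P Y j B A V.
Proof.
move=> pair; right; right => t b a bB aA.
have [/set1_neq0//|[/set1_neq0//|]] := pair a b aA bB.
by move=> /(_ t b a); rewrite !inE !eqxx => /(_ isT isT).
Qed.

End MarkovProperty.

(** In a graph whose edges mark the failure of a relation between pairs, the
    relation holds between [A] and every vertex that is neither in [A] nor
    adjacent to [A]. *)
Lemma non_edge (V : finType) (r : V -> V -> Prop) (A : {set V}) (a b : V) :
  a \in A ->
  b \in ([set: V] :\: ((\bigcup_(a in A) [set v | (v != a) && ~~ `[< r v a >]])
    :|: A))%SET ->
  r b a.
Proof.
move=> aA; rewrite !inE negb_or => /andP[/andP[bN bA] _]; apply: contrapT => H.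
case/negP: bN; apply/bigcupP; exists a => //; rewrite inE.
rewrite (contraNneq _ bA) => [/=|->//].
by apply/asboolPn.
Qed.

Theorem proposition5p13 (R : realType) (d : measure_display)
  (T : measurableType d) (P : probability T R) (k : nat)
  (Y : 'I_k -> R -> T -> R[i])
  (Ystat : weakly_stationary P Y) (Ycent : centered P Y)
  (Ycont : ms_continuous P Y)
  (Yspec : spectral_density_condition P Y)
  (Ypnd : purely_nondeterministic P Y) :
  (let G := orthogonality_graph P Y in
   forall A : {set 'I_k},
     not_causes P Y ([set: 'I_k] :\: (pa G A :|: A))%SET A [set: 'I_k]%SET /\
     not_contemp P Y ([set: 'I_k] :\: (ne G A :|: A))%SET A [set: 'I_k]%SET) /\
  (forall j : 'I_k -> nat,
     (forall v, ms_derivablen P (j v) (Y v) /\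
                ~ ms_derivablen P (j v).+1 (Y v)) ->
   let G := local_orthogonality_graph P Y j in
   forall A : {set 'I_k},
     not_causes0 P Y j ([set: 'I_k] :\: (pa G A :|: A))%SET A
       [set: 'I_k]%SET /\
     not_contemp0 P Y j ([set: 'I_k] :\: (ne G A :|: A))%SET A
       [set: 'I_k]%SET).
Proof.
have [Y2 _] := Ystat.
split=> [G A|j _ G A]; split.
- apply: not_causes_block => // a b aA.
  exact: (non_edge (r := fun v a => not_causes P Y [set v]%SET [set a]%SET _)).
- apply: not_contemp_block => // a b aA.
  exact: (non_edge (r := fun v a => not_contemp P Y [set v]%SET [set a]%SET _)).
- apply: not_causes0_block => // a b aA.
  exact: (non_edge (r := fun v a => not_causes0 P Y j [set v]%SET [set a]%SET
    _)).
- apply: not_contemp0_block => // a b aA.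
  exact: (non_edge (r := fun v a => not_contemp0 P Y j [set v]%SET [set a]%SET
    _)).
Qed.
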